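(* Let $\mathcal{X}$ be a Banach space and consider the problem $$\dot u=F(t,u)+f(t),\quad t\ge 0,\qquad u(0)=u_0,$$ where, with $p>1$, $$\|F(t,u)-F'_u(t,0)u\|\le\alpha(t)\|u\|^p,\qquad \|f(t)\|\le\beta(t),\qquad t\ge 0,\ u\in\mathcal{X},$$ under the setting described in the context. Assume that the local solvability Assumption A of the context holds and that $$\omega:=\sup_{t\ge 0}\left(\frac{\beta(t)}{\alpha(t)}\right)^{\frac1p}\frac{1}{\|U(t)\|}<\frac{1}{\left[(p-1)\int_0^\infty\|U^{-1}(\xi)\|\,\|U(\xi)\|^p\alpha(\xi)\,d\xi\right]^{\frac{1}{p-1}}}-\|u(0)\| .$$ Then the solution $u(t)$ to the problem exists globally and satisfies $$\|u(t)\|\le C_2\|U(t)\|,\qquad t\ge 0,\quad C_2=\mathrm{const}>0 .$$ Consequently: (i) if $\sup_{t\ge0}\|U(t)\|<\infty$, then the solution $u(t)$ is bounded; (ii) if $\lim_{t\to\infty}\|U(t)\|=0$, then $\lim_{t\to\infty}u(t)=0$.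
   Context: $F(t,u)$ is an operator function from $\mathbb{R}\times\mathcal{X}$ to $\mathcal{X}$, nonlinear in general for fixed $t\ge 0$; $F'_u(t,u)$ denotes its Fréchet derivative with respect to $u$ for fixed $t$, and $B(t):=F'_u(t,0):=F'_u(t,u)|_{u=0}$. $f$ is a function on $[0,\infty)$ with values in $\mathcal{X}$. The functions $\alpha,\beta$ are nonnegative and in $L^1_{loc}([0,\infty))$, and $\|B(t)\|$ is in $L^1_{loc}([0,\infty))$. $\|\cdot\|$ denotes the norm of $\mathcal{X}$ or the operator norm. $U(t)$ is the solution to $\frac{d}{dt}U(t)=B(t)U(t)$, $t\ge0$, $U(0)=I$, where $I$ is the identity operator in $\mathcal{X}$; it exists globally, and its inverse $U^{-1}(t)$ exists for every $t\ge 0$ and solves $\frac{d}{dt}U^{-1}(t)=-U^{-1}(t)B(t)$, $U^{-1}(0)=I$. A solution means a classical solution: a global solution is a continuously differentiable function on $[0,\infty)$ with values in $\mathcal{X}$ satisfying the equation; a local one is such a function on some $[0,T)$, $T>0$ (on $[t_0,t_0+T)$ when starting at $t_0$). Assumption A: the problem $\dot u=F(t,u)+f(t)$, $t\ge t_0$, $u(t_0)=\tilde u_0$, has a unique local solution for any $t_0\ge 0$ and $\tilde u_0\in B(0,R)\subset\mathcal{X}$, where $B(0,R)$ is the ball centered at the origin with radius $R$ and $R>0$ is sufficiently large.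
   Formalization: F is assumed jointly continuous on [0,∞)×X and f continuous on [0,∞) (for a step function f no classical global solution exists); in Assumption A, ''R sufficiently large'' means R > C_2‖U(t)‖ for all t, with R = ∞ if ‖U‖ is unbounded. *)

(* Defs.v *)
From HB Require Import structures.
From mathcomp Require Import all_boot all_order all_algebra.
From mathcomp Require Import all_classical all_reals all_analysis.
Set Implicit Arguments.
Unset Strict Implicit.
Unset Printing Implicit Defensive.
Import Order.TTheory GRing.Theory Num.Theory.
Import numFieldNormedType.Exports.
Local Open Scope classical_set_scope.
Local Open Scope ring_scope.

(* [sup] is 0 on unbounded sets, so this is the operator norm of bounded linear
   operators only. *)
Definition opnorm (R : realType) (X : normedModType R) (A : X -> X) : R :=
  sup [set `|A x| | x in [set x : X | `|x| <= 1]].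

(* One-sided at the endpoints of an interval I. *)
Definition derives_within (R : realType) (X : normedModType R) (I : set R)
    (u : R -> X) (t : R) (l : X) : Prop :=
  (s - t)^-1 *: (u s - u t) @[s --> within I t^'] --> l.

(* The same, for operator-valued functions, in the operator norm. *)
Definition op_derives_within (R : realType) (X : normedModType R) (I : set R)
    (A : R -> X -> X) (t : R) (L : X -> X) : Prop :=
  opnorm (fun x => (s - t)^-1 *: (A s x - A t x) - L x)
    @[s --> within I t^'] --> (0 : R).

Definition L1loc (R : realType) (a : R -> R) : Prop :=
  forall T : R, 0 <= T ->
    (@lebesgue_measure R).-integrable `[0, T] (EFin \o a).

(* B(t) = F'_u(t, 0); meaningful when F t is differentiable at 0. *)
Definition lin0 (R : realType) (X : normedModType R) (F : R -> X -> X)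
    (t : R) : X -> X := 'd (F t) (0 : X).

Definition is_evolution (R : realType) (X : normedModType R)
    (B : R -> X -> X) (U Uinv : R -> {linear X -> X}) : Prop :=
  [/\ forall t : R, 0 <= t -> continuous (U t) /\ continuous (Uinv t),
      forall x, U 0 x = x /\ Uinv 0 x = x,
      forall t : R, 0 <= t -> cancel (U t) (Uinv t) /\ cancel (Uinv t) (U t),
      forall t : R, 0 <= t -> op_derives_within `[0, +oo[ (fun s => U s : X -> X) t
                            (fun x => B t (U t x))
    & forall t : R, 0 <= t -> op_derives_within `[0, +oo[ (fun s => Uinv s : X -> X) t
                            (fun x => - Uinv t (B t x))].

(* Classical (continuously differentiable) solution on the interval I of
   u' = F(t, u) + f(t), u(t0) = x0: continuity of u' on I is expressed on the
   right-hand side, to which u' is equal. *)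
Definition solution (R : realType) (X : normedModType R) (F : R -> X -> X)
    (f : R -> X) (t0 : R) (x0 : X) (I : set R) (u : R -> X) : Prop :=
  [/\ u t0 = x0,
      forall t, I t -> derives_within I u t (F t (u t) + f t)
    & {within I, continuous (fun t => F t (u t) + f t)}].

(* The radius r is extended so that r = +oo makes the ball the whole space. *)
Definition locally_solvable (R : realType) (X : normedModType R)
    (F : R -> X -> X) (f : R -> X) (r : \bar R) : Prop :=
  forall (t0 : R) (x0 : X), 0 <= t0 -> (`|x0|%:E < r)%E ->
  exists T : R, exists u : R -> X,
    [/\ 0 < T, solution F f t0 x0 `[t0, t0 + T[ u
      & forall (T' : R) (w : R -> X), 0 < T' ->
          solution F f t0 x0 `[t0, t0 + T'[ w ->
          forall t, t0 <= t -> t < t0 + T -> t < t0 + T' -> w t = u t].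

(* Extended-real quotients: c / 0 is +oo for c > 0, and 0 / 0 is 0, so a point
   with alpha(t) = 0 forces beta(t) = 0 as soon as omega is finite. *)
Definition omega (R : realType) (X : normedModType R) (p : R)
    (alpha beta : R -> R) (U : R -> X -> X) : \bar R :=
  ereal_sup [set (((beta t)%:E / (alpha t)%:E) `^ p^-1
                    * (opnorm (U t))%:E^-1)%E | t in `[0, +oo[ ].

(* 1 / [(p-1) int_0^oo ||U^-1|| ||U||^p alpha]^(1/(p-1)): it is +oo when the
   integral vanishes and 0 when the integral diverges. *)
Definition threshold (R : realType) (X : normedModType R) (p : R)
    (alpha : R -> R) (U Uinv : R -> X -> X) : \bar R :=
  ((((p - 1)%:E *
     \int[@lebesgue_measure R]_(xi in `[0%R, +oo[)
        (opnorm (Uinv xi) * opnorm (U xi) `^ p * alpha xi)%:E)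
    `^ (p - 1)^-1)^-1)%E.

(* Main.v *)
Require Import Defs.
From HB Require Import structures.
From mathcomp Require Import all_boot all_order all_algebra.
From mathcomp Require Import all_classical all_reals all_analysis.
From mathcomp Require Import measurable_realfun ring lra.
Set Implicit Arguments.
Unset Strict Implicit.
Unset Printing Implicit Defensive.
Import Order.TTheory GRing.Theory Num.Theory.
Import numFieldNormedType.Exports.
Local Open Scope classical_set_scope.
Local Open Scope ring_scope.

(** Pull the solution back along the linear flow: with [v t = Uinv t (u t)] the
linear part of the equation disappears, and
[v' = Uinv (F(t, u) - B u + f)] satisfies
[|v'| <= a (|v|^p + omega^p) <= a (|v| + omega)^p], where
[a = |Uinv| |U|^p alpha] and [beta <= alpha (omega |U|)^p] by the definition of
[omega]. Hence [G = |v| + w], with [w] slightly larger than [omega], grows at most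
like the solution of [y' = a y^p]; that is, [G^(1-p)] decreases at rate at most
[(p-1) a], so that
[G(t)^(1-p) >= (|u0| + w)^(1-p) - (p-1) int_0^oo a]. The hypothesis on [omega] says
precisely that the right-hand side stays positive for a suitable [w]
([threshold_margin]). This bounds [v] by a constant, hence [u] by that constant
times [|U t|] ([pullback_bound], [solution_bound]).

The functions [alpha] and [a] are only integrable, whereas [v] is differentiable at
every point but [v'] need not be bounded by a continuous function, so
the inequality for [G] cannot be integrated by a naive fundamental theorem of
calculus. Instead, [a] is dominated as in the Vitali-Caratheodory theorem: there is
a nondecreasing [Psi] whose increments just to the right of each [x] are at
least [a x * (y - x)], and whose total increment is at most [int a + eps]
([vitali_caratheodory]). Comparing local increments with those of [Psi] is then a
real induction ([le_increment_local]).

For the global existence, two solutions coincide by real induction, since the bound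
keeps them in the ball where local uniqueness holds ([solution_unique]). On a
bounded interval [[0, T[] the same domination makes [v] Cauchy at [T]
([pullback_cauchy]); hence [u] has a limit there, which is again in the ball, and
the local solution started at that limit extends [u] ([solution_extends]). The
supremum of the existence times is therefore infinite. *)

(** * Comparison of local increments *)

Section Increments.
Context {R : realType}.

(** Induction along an interval: a property that propagates a little to the right of
any point up to which it holds, and passes to limits from the left, holds at the
right end; otherwise consider the supremum of the points up to which it holds. *)
Lemma real_induction (P : R -> Prop) (s t : R) : s <= t -> P s ->
  (forall x, s <= x -> x < t -> (forall z, s <= z -> z <= x -> P z) ->
     \forall y \near x^'+, P y) ->
  (forall x, s < x -> x <= t -> (forall z, s <= z -> z < x -> P z) -> P x) ->
  P t.
Proof.
move=> st Ps right left.
pose E := [set y | s <= y <= t /\ forall z, s <= z -> z <= y -> P z].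
have Es : E s.
  split; first by rewrite lexx st.
  by move=> z sz zs; have -> : z = s by apply/eqP; rewrite eq_le sz zs.
have supE : has_sup E by split; [exists s|exists t => y [/andP[]]].
pose c := sup E.
have sc : s <= c by apply: ub_le_sup => //; case: supE.
have ct : c <= t by apply: ge_sup => [|y [/andP[]]]//; exists s.
have Plt z : s <= z -> z < c -> P z.
  move=> sz zc; have cz : 0 < c - z by rewrite subr_gt0.
  have [y [_ gy] zy] := sup_adherent cz supE.
  by apply: gy => //; move: zy; rewrite -/c; lra.
have Pc : P c.
  by move: sc; rewrite le_eqVlt => /predU1P[<-//|sc]; exact: left.
have Ple z : s <= z -> z <= c -> P z.
  by move=> sz; rewrite le_eqVlt => /predU1P[->//|]; exact: Plt.
move: (ct); rewrite le_eqVlt => /predU1P[<-//|clt].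
exfalso.
have [d /= d0 hd] := right _ sc clt Ple.
pose m := Num.min t (c + d / 2).
have cm : c < m by rewrite lt_min clt/=; lra.
have mt : m <= t by rewrite ge_min lexx.
have md : m < c + d by rewrite gt_min; apply/orP; right; lra.
have : m <= c.
  apply: ub_le_sup; first by case: supE.
  split; first by rewrite mt (le_trans sc (ltW cm)).
  move=> z sz zm; have [zc|cz] := leP z c; first exact: Ple.
  by apply: hd => //=; rewrite distrC ger0_norm; lra.
by rewrite leNgt cm.
Qed.

(** A mean value inequality without derivatives: [phi] cannot outgrow [Psi] over an
interval if it does not do so immediately to the right of any point. [Psi] may
jump upwards, which only helps; [phi] must not jump upwards when a point is
reached from the left. *)
Lemma le_increment_local (phi Psi : R -> R) (s t : R) : s <= t ->
  (forall x y, s <= x -> x <= y -> y <= t -> Psi x <= Psi y) ->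
  (forall x, s < x -> x <= t -> forall e, 0 < e ->
     \forall y \near x^'-, phi x <= phi y + e) ->
  (forall x, s <= x -> x < t ->
     \forall y \near x^'+, phi y - phi x <= Psi y - Psi x) ->
  phi t - phi s <= Psi t - Psi s.
Proof.
move=> st Psim left right.
apply: (real_induction (P := fun y => phi y - phi s <= Psi y - Psi s) st).
- by rewrite !subrr.
- move=> x sx xt /(_ x sx (lexx x)) hx.
  by apply: filterS (right x sx xt) => y; lra.
- move=> x sx xt hx; apply/ler_addgt0Pr => e e0.
  have : \forall y \near x^'-, phi x - phi s <= Psi x - Psi s + e.
    near=> y.
    have yx : y < x by near: y; exact: nbhs_left_lt.
    have sy : s < y by near: y; exact: nbhs_left_gt.
    have h1 : phi x <= phi y + e by near: y; exact: left.
    have h2 := hx _ (ltW sy) yx.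
    have h3 := Psim _ _ (ltW sy) (ltW yx) xt.
    lra.
  by move=> H; have [y] := filter_ex H.
Unshelve. all: by end_near. Qed.

Notation mu := (@lebesgue_measure R).

(** Layer-cake representation: for large [n], the sum is [h] rounded down to a multiple
of [e], plus one more [e]. *)
Lemma sum_layers_le (h e : R) n : 0 <= h -> 0 < e ->
  \sum_(0 <= k < n) e * ((k%:R * e <= h)%R)%:R <= h + e.
Proof.
move=> h0 e0.
suff : \sum_(0 <= k < n) e * ((k%:R * e <= h)%R)%:R <= h + e /\
   \sum_(0 <= k < n) e * ((k%:R * e <= h)%R)%:R <= n%:R * e by case.
elim: n => [|n [IH1 IH2]]; first by rewrite big_geq// mul0r; split; lra.
rewrite big_nat_recr//=; case: (leP (n%:R * e) h) => nh /=; last by rewrite -natr1; split; lra.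
by rewrite -natr1; split; lra.
Qed.


(** Enlarge each level set [E k] of [h] to an open set [V k] of almost the same
measure. The function [e * sum_k 1_(V k)] is then lower semicontinuous, dominates
[h], and has almost the same integral; [Psi] is its primitive. Lower
semicontinuity is what makes the domination of [h x] persist to the right of [x],
so that it holds for the increments of [Psi] at every point and not merely almost
everywhere. *)
Lemma vitali_caratheodory (h : R -> R) (s t eps : R) : s <= t -> 0 < eps ->
  (forall x, s <= x -> x <= t -> 0 <= h x) ->
  mu.-integrable `[s, t] (EFin \o h) ->
  exists Psi : R -> R,
  [/\ forall x y, x <= y -> Psi x <= Psi y,
      forall x, s <= x -> x < t ->
        \forall y \near x^'+, h x * (y - x) <= Psi y - Psi x
    & Psi t - Psi s <= fine (\int[mu]_(x in `[s, t]) (h x)%:E)%E + eps].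
Proof.
move=> st eps0 h0 ih.
have ts1 : 0 < t - s + 1 by lra.
(* Rounding [h] costs at most [e] per unit length, enlarging the [E k] at most [e]
   in total. *)
pose e := eps / (t - s + 1).
have e0 : 0 < e by rewrite divr_gt0.
have eE : e * (t - s) + e = eps.
  by rewrite -[X in _ + X]mulr1 -mulrDr /e divfK// gt_eqF.
have mh : measurable_fun `[s, t] h by apply/measurable_EFinP; apply: measurable_int ih.
have mst : measurable (`[s, t]%classic : set R) by exact: measurable_itv.
pose E k := (`[s, t] `&` [set x | (k%:R * e)%:E <= (EFin \o h) x]%E)%classic : set R.
have mE k : measurable (E k) by apply: emeasurable_fun_c_infty => //; exact/measurable_EFinP.
have mind k : measurable_fun `[s, t] (\1_(E k) : R -> R).
  apply: measurable_indic; exact: mE.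
have meind k : measurable_fun `[s, t] (fun x => (e * \1_(E k) x)%:E).
  apply/measurable_EFinP; apply: measurable_funM; [exact: measurable_cst|exact: mind].
have muST : mu `[s, t]%classic = (t - s)%:E.
  rewrite lebesgue_measure_itv/= lte_fin; case: ltP => //.
  by move=> ts; congr EFin; lra.
have muE k : (mu (E k) < +oo)%E.
  rewrite (@le_lt_trans _ _ (mu `[s, t]%classic))//.
    by apply: le_measure; rewrite ?inE; [exact: mE|exact: mst|exact: subIsetl].
  by rewrite muST ltry.
have intE k : (\int[mu]_(x in `[s, t]) (e * \1_(E k) x)%:E = e%:E * mu (E k))%E.
  under eq_integral do rewrite EFinM.
  rewrite ge0_integralZl_EFin; [|exact: mst|by move=> x _; rewrite lee_fin| |exact: ltW].
    rewrite integral_indic; [|exact: mst|exact: mE].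
    by congr (_ * mu _)%E; rewrite /E setIAC setIid.
  by apply/measurable_EFinP; exact: mind.
have /choice[V hV] k : exists V : set R,
    [/\ open V, E k `<=` V & (mu (V `\` E k) < (1 / (2 ^ k.+1)%:R)%:E)%E].
  apply: lebesgue_regularity_outer; [exact: mE|exact: muE|].
  by rewrite divr_gt0// ltr0n expn_gt0.
have mV k : measurable (V k) by have [? _ _] := hV k; exact: open_measurable.
pose P (y : R) : \bar R := (\sum_(k <oo) e%:E * mu (V k `&` `]-oo, y]))%E.
have mI k (i : interval R) : measurable (V k `&` [set` i]).
  by apply: measurableI => //; exact: measurable_itv.
have term0 k (i : interval R) : (0 <= e%:E * mu (V k `&` [set` i]))%E.
  by rewrite mule_ge0// lee_fin ltW.
have leint : (\sum_(k <oo) e%:E * mu (E k) <=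
    \int[mu]_(x in `[s, t]) (h x)%:E + (e * (t - s))%:E)%E.
  apply: lime_le.
    by apply: is_cvg_nneseries => n _ _; rewrite mule_ge0// lee_fin ltW.
  apply: nearW => n.
  have -> : (\sum_(0 <= k < n) e%:E * mu (E k) =
      \int[mu]_(x in `[s, t]) \sum_(0 <= k < n) (e * \1_(E k) x)%:E)%E.
    rewrite ge0_integral_sum//=; first last.
      by move=> k x _; rewrite lee_fin mulr_ge0// ltW.
    apply: eq_bigr => k _; exact/esym/intE.
  have -> : (\int[mu]_(x in `[s, t]) (h x)%:E + (e * (t - s))%:E =
     \int[mu]_(x in `[s, t]) ((h x)%:E + e%:E))%E.
    have ce : (\int[mu]_(x in `[s, t]) e%:E = (e * (t - s))%:E)%E.
      by rewrite (integral_cst mu mst) [X in (_ * X)%E]muST EFinM.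
    rewrite ge0_integralD.
    - by rewrite ce.
    - exact: mst.
    - by move=> x /=; rewrite in_itv/= => /andP[sx xt]; rewrite lee_fin h0.
    - exact/measurable_EFinP.
    - by move=> x _; rewrite lee_fin ltW.
    - exact: measurable_cst.
  apply: ge0_le_integral; first exact: mst.
  - move=> x _; apply: sume_ge0 => k _; by rewrite lee_fin mulr_ge0// ltW.
  - apply: emeasurable_sum => k; exact: meind.
  - by apply: emeasurable_funD; [exact/measurable_EFinP|exact: measurable_cst].
  - move=> x /= xst; rewrite sumEFin lee_fin.
    rewrite (_ : (\sum_(0 <= k < n) e * \1_(E k) x)%R =
      (\sum_(0 <= k < n) e * ((k%:R * e <= h x)%R)%:R)%R).
      apply: sum_layers_le => //; move: xst; rewrite in_itv/= => /andP[]; exact: h0.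
    apply: eq_bigr => k _; rewrite indicE.
    rewrite (_ : (x \in E k) = (k%:R * e <= h x)%R)//.
    apply/idP/idP; first by rewrite inE /E /= lee_fin => -[].
    by move=> kh; rewrite inE /E /= lee_fin; split.
have sumV : (\sum_(k <oo) e%:E * mu (V k) <=
    \int[mu]_(x in `[s, t]) (h x)%:E + eps%:E)%E.
  apply: (@le_trans _ _ (\sum_(k <oo) (e%:E * mu (E k) + (e / (2 ^ k.+1)%:R)%:E))%E).
    apply: lee_nneseries => k _ //.
      by move=> _; rewrite mule_ge0// lee_fin ltW.
    have [oV EV lV] := hV k.
    have -> : mu (V k) = (mu (E k) + mu (V k `\` E k))%E.
      rewrite -measureU; [by rewrite setDUK|exact: mE| |by rewrite setDIK].
      exact: (measurableD (mV k) (mE k)).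
    rewrite muleDr//.
    - apply: leeD2l.
      have -> : (e / (2 ^ k.+1)%:R)%:E = (e%:E * (1 / (2 ^ k.+1)%:R)%:E)%E.
        by rewrite div1r -EFinM.
      by apply: lee_wpmul2l; [rewrite lee_fin ltW|exact: ltW].
    - by rewrite ge0_adde_def// inE.
  apply: (le_trans (epsilon_trick _ _ _)).
  - by move=> k; rewrite mule_ge0// lee_fin ltW.
  - exact: ltW.
  rewrite -eE EFinD addeA; exact: leeD2r.
have iy : (\int[mu]_(x in `[s, t]) (h x)%:E)%E \is a fin_num.
  exact: integrable_fin_num.
have sVy : (\int[mu]_(x in `[s, t]) (h x)%:E + eps%:E < +oo)%E.
  by rewrite lte_add_pinfty ?ltry// ltey_eq iy.
have Ple y : (P y <= \sum_(k <oo) e%:E * mu (V k))%E.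
  apply: lee_nneseries => k _ //.
  apply: lee_wpmul2l; first by rewrite lee_fin ltW.
  by apply: le_measure; rewrite ?inE; [exact: mI|exact: mV|exact: subIsetl].
have P0 y : (0 <= P y)%E by apply: nneseries_ge0.
have Pfin y : P y \is a fin_num.
  by rewrite ge0_fin_numE// (le_lt_trans (Ple y))// (le_lt_trans sumV).
exists (fine \o P); split => [x y xy|x sx xt|] /=.
- rewrite fine_le//; apply: lee_nneseries => k _ //.
  apply: lee_wpmul2l; first by rewrite lee_fin ltW.
  apply: le_measure; rewrite ?inE; [exact: mI|exact: mI|].
  by apply: setIS => z /=; rewrite !in_itv/= => zx; exact: le_trans xy.
- have xh0 : 0 <= h x by apply: h0 => //; exact: ltW.
  (* [x] lies in the first [K] of the sets [V k], hence so does an interval to its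
     right; these [K] terms alone contribute [e * K >= h x] per unit length. *)
  pose K := (Num.truncn (h x / e)).+1.
  have hK : h x <= e * K%:R.
    by rewrite mulrC -ler_pdivrMr//; apply/ltW/truncnS_gt.
  have VK k : (k < K)%N -> V k x.
    have [_ EV _] := hV k => kK; apply: EV; split => /=.
      by rewrite in_itv/= sx ltW.
    have /le_trans : k%:R <= (Num.truncn (h x / e))%:R :> R by rewrite ler_nat.
    by rewrite lee_fin -ler_pdivlMr//; apply; rewrite truncn_le divr_ge0// ltW.
  have : \forall y \near x^'+, forall k : 'I_K, `]x, y] `<=` V k.
    apply: filter_forall => k; have [oV _ _] := hV k.
    have /nbhs_ballP[d /= d0 dV] : nbhs x (V k) by apply: open_nbhs_nbhs; split => //; exact: VK.
    near=> y => z /=; rewrite in_itv/= => /andP[xz zy]; apply: dV => /=.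
    have yd : y < x + d by near: y; apply: nbhs_right_lt; rewrite ltrDl.
    by rewrite /ball/= ltr0_norm; lra.
  apply: filterS2 (nbhs_right_gt x) => y xy yV.
  rewrite -lee_fin EFinB !fineK// leeBrDr//.
  have -> : P y = (P x + \sum_(k <oo) e%:E * mu (V k `&` `]x, y]))%E.
    rewrite /P -nneseriesD//; apply: eq_eseriesr => k _.
    rewrite -muleDr//; last by rewrite ge0_adde_def// inE.
    congr (_ * _)%E; rewrite -measureU; [|exact: mI|exact: mI|].
    - by rewrite -setIUr -itv_bndbnd_setU ?bnd_simp// ltW.
    - apply/seteqP; split => // z [[_ zx] [_ xz]].
      move: zx xz; rewrite /mkset !in_itv/= => zx /andP[xz _].
      by have := le_lt_trans zx xz; rewrite ltxx.
  rewrite addeC; apply: leeD2l.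
  apply: (le_trans _ (nneseries_lim_ge K _)); last by move=> n _ _; exact: term0.
  rewrite big_mkord (eq_bigr (fun=> (e * (y - x))%:E)) => [|k _]; last first.
    rewrite (_ : V k `&` _ = `]x, y]%classic); last by apply/setIidr; exact: yV.
    by rewrite [mu _]lebesgue_measure_itv/= lte_fin xy EFinM.
  rewrite sumEFin sumr_const card_ord lee_fin.
  by rewrite -mulrnAl -[e *+ K]mulr_natr; apply: ler_wpM2r => //; rewrite subr_ge0 ltW.
- have : fine (P t) <= fine (\int[mu]_(x in `[s, t]) (h x)%:E)%E + eps.
    by rewrite -lee_fin EFinD !fineK//; exact: (le_trans (Ple t) sumV).
  have := fine_ge0 (P0 s); lra.
Unshelve. all: by end_near. Qed.

End Increments.

(** * Operator norms and one-sided derivatives *)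

Section Derivatives.
Context {R : realType} {X : normedModType R}.
Implicit Types (A L : X -> X) (u : R -> X) (I : set R).

(** The part of bounded linearity on which [opnorm] depends. It is a predicate on plain
functions because difference quotients of operators are not packaged as linear
maps. *)
Definition homogeneous_bounded A :=
  (forall c x, A (c *: x) = c *: A x) /\ exists M, forall x, `|A x| <= M * `|x|.

Lemma near_dist_lt (t e : R) : 0 < e -> \forall s \near t, `|s - t| < e.
Proof. by move=> e0; exists e => //= s; rewrite distrC. Qed.

Lemma opnorm_ge0 A : 0 <= opnorm A.
Proof.
rewrite /opnorm; set S := (X in sup X).
have S0 : S `|A 0| by exists 0 => //=; rewrite normr0.
have [supS|/sup_out->//] := pselect (has_sup S).
by apply: le_trans (normr_ge0 (A 0)) _; apply: ub_le_sup => //; case: supS.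
Qed.

Lemma le_opnorm A x : homogeneous_bounded A -> `|A x| <= opnorm A * `|x|.
Proof.
move=> [hA [M hM]]; have [->|x0] := eqVneq x 0.
  by have := hA 0 0; rewrite !scale0r => ->; rewrite !normr0 mulr0.
have nx : 0 < `|x| by rewrite normr_gt0.
rewrite -ler_pdivrMr//.
have -> : `|A x| / `|x| = `|A (`|x|^-1 *: x)|.
  by rewrite hA normrZ ger0_norm ?invr_ge0// mulrC.
apply: ub_le_sup; last first.
  exists (`|x|^-1 *: x) => //=.
  by rewrite normrZ ger0_norm ?invr_ge0// mulVf// gt_eqF.
exists `|M| => _ [y /= y1 <-]; apply: (le_trans (hM y)).
by apply: (le_trans (ler_norm _)); rewrite normrM normr_id ler_piMr.
Qed.

Lemma opnorm_le A M : 0 <= M -> (forall x, `|A x| <= M * `|x|) -> opnorm A <= M.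
Proof.
move=> M0 hM; apply: ge_sup; first by exists `|A 0|, 0 => //=; rewrite normr0.
by move=> _ [y /= y1 <-]; apply: (le_trans (hM y)); rewrite ler_piMr.
Qed.

Lemma homogeneous_bounded_linear (A : {linear X -> X}) :
  continuous A -> homogeneous_bounded A.
Proof.
move=> cA; split=> [c x|]; first by rewrite linearZ.
have /linear_boundedP bA := @continuous_linear_bounded _ _ _ 0 A (cA 0).
by have [M hM] := filter_ex bA; exists M.
Qed.

Lemma homogeneous_bounded_comp A L :
  homogeneous_bounded A -> homogeneous_bounded L ->
  homogeneous_bounded (fun x => A (L x)).
Proof.
move=> [hA bA] [hL bL].
split=> [c x|]; first by rewrite hL hA.
exists (opnorm A * opnorm L) => x.
apply: (le_trans (le_opnorm _ _)) => //.
by rewrite -mulrA ler_wpM2l ?opnorm_ge0//; apply: le_opnorm.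
Qed.

Lemma homogeneous_boundedN A :
  homogeneous_bounded A -> homogeneous_bounded (fun x => - A x).
Proof.
move=> [hA [M bA]]; split=> [c x|]; first by rewrite hA scalerN.
by exists M => x; rewrite normrN.
Qed.

(** Derivative at [t] within [I], as a first-order expansion without quotient: the
point [s = t] needs no exception, and restricting [I] or changing [u] away from
[t] is immediate. *)
Definition first_order I u t l := forall e : R, 0 < e ->
  \forall s \near t, I s -> `|u s - u t - (s - t) *: l| <= e * `|s - t|.

Lemma near_within_dnbhs I t (P : R -> Prop) :
  (\forall s \near within I t^', P s) <->
  (\forall s \near t, s != t -> I s -> P s).
Proof.
rewrite near_withinE near_withinE; split; apply: filterS => s.
  by move=> h st Is; exact: h.
by move=> h /= /eqP st Is; apply: h => //; exact/eqP.
Qed.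

Lemma derives_withinP I u t l : derives_within I u t l <-> first_order I u t l.
Proof.
have key s e : s != t ->
    (`|l - (s - t)^-1 *: (u s - u t)| <= e) =
    (`|u s - u t - (s - t) *: l| <= e * `|s - t|).
  move=> st; have st0 : 0 < `|s - t| by rewrite normr_gt0 subr_eq0.
  have -> : `|l - (s - t)^-1 *: (u s - u t)| = `|s - t|^-1 * `|u s - u t - (s - t) *: l|.
    rewrite -normfV -normrZ [in RHS]scalerBr [in RHS]scalerA mulVf ?subr_eq0//.
    by rewrite scale1r distrC.
  by rewrite mulrC ler_pdivrMr.
rewrite /derives_within; split.
  move=> /cvgrPdist_le h e e0; have /near_within_dnbhs := h _ e0.
  apply: filterS => s hs Is; have [->|st] := eqVneq s t.
    by rewrite !subrr scale0r subrr !normr0 !mulr0.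
  by rewrite -key//; exact: hs.
move=> h; apply/cvgrPdist_le => e e0; apply/near_within_dnbhs.
by apply: filterS (h e e0) => s hs st Is; rewrite key//; exact: hs.
Qed.

(** The remainder is small uniformly in [x], so that the expansion may be applied to a
vector [x] that itself moves with [s]. *)
Lemma op_derives_within_first_order I (A : R -> X -> X) t L :
  I t -> (forall s, I s -> homogeneous_bounded (A s)) -> homogeneous_bounded L ->
  op_derives_within I A t L -> forall e : R, 0 < e ->
  \forall s \near t, I s -> forall x,
    `|A s x - A t x - (s - t) *: L x| <= e * `|s - t| * `|x|.
Proof.
move=> It hA hL /cvgrPdist_le h e e0; have /near_within_dnbhs := h _ e0.
apply: filterS => s hs Is x; have [->|st] := eqVneq s t.
  by rewrite !subrr scale0r subrr !normr0 mulr0 mul0r.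
have := hs st Is; rewrite sub0r normrN ger0_norm ?opnorm_ge0// => {}hs.
have st0 : 0 < `|s - t| by rewrite normr_gt0 subr_eq0.
set D := (fun x => _) in hs.
have hD : homogeneous_bounded D.
  have [h1 [M1 b1]] := hA _ Is; have [h2 [M2 b2]] := hA _ It.
  have [h3 [M3 b3]] := hL; split.
    move=> c y; rewrite /D h1 h2 h3 -!scalerBr scalerA mulrC -scalerA.
    by rewrite -scalerBr.
  exists (`|s - t|^-1 * (M1 + M2) + M3) => y; rewrite /D.
  apply: (le_trans (ler_normB _ _)); rewrite mulrDl lerD// normrZ normfV -mulrA.
  rewrite ler_wpM2l// mulrDl; apply: (le_trans (ler_normB _ _)); exact: lerD.
have -> : A s x - A t x - (s - t) *: L x = (s - t) *: D x.
  by rewrite /D scalerBr scalerA mulfV ?scale1r// subr_eq0.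
rewrite normrZ (mulrC e) -mulrA ler_pM2l//.
by apply: (le_trans (le_opnorm x hD)); rewrite ler_wpM2r.
Qed.

Lemma first_order_near_lipschitz I u t l : first_order I u t l ->
  forall e, 0 < e -> \forall s \near t, I s -> `|u s - u t| <= (`|l| + e) * `|s - t|.
Proof.
move=> h e e0; apply: filterS (h e e0) => s hs Is.
rewrite -[u s - u t](subrK ((s - t) *: l)) mulrDl addrC.
apply: (le_trans (ler_normD _ _)); rewrite normrZ mulrC lerD//; exact: hs.
Qed.

Lemma near_lipschitz_continuous I u t M :
  (\forall s \near t, I s -> `|u s - u t| <= M * `|s - t|) ->
  forall e, 0 < e -> \forall s \near t, I s -> `|u s - u t| <= e.
Proof.
move=> h e e0; have M0 : 0 < `|M| + 1 by have := normr_ge0 M; lra.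
near=> s => Is.
apply: le_trans (_ : (`|M| + 1) * `|s - t| <= e).
  apply: (@le_trans _ _ (M * `|s - t|)); first by move: Is; near: s.
  by rewrite ler_wpM2r//; have := ler_norm M; lra.
rewrite mulrC -ler_pdivlMr//; apply: ltW; near: s.
by apply: near_dist_lt; exact: divr_gt0.
Unshelve. all: by end_near. Qed.

End Derivatives.

Lemma norm_increment {R : realType} {X : normedModType R} (v : R -> X)
    (Psi : R -> R) (s t : R) : s <= t ->
  (forall x y, s <= x -> x <= y -> y <= t -> Psi x <= Psi y) ->
  (forall x, s < x -> x <= t -> forall e, 0 < e ->
     \forall y \near x^'-, `|v y - v x| <= e) ->
  (forall x, s <= x -> x < t ->
     \forall y \near x^'+, `|v y - v x| <= Psi y - Psi x) ->
  `|v t - v s| <= Psi t - Psi s.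
Proof.
move=> st Psim left right.
have -> : `|v t - v s| = `|v t - v s| - `|v s - v s| by rewrite subrr normr0 subr0.
have tri x y : `|v y - v s| <= `|v x - v s| + `|v y - v x|.
  by rewrite [leRHS]addrC; exact: ler_distD.
apply: (le_increment_local (phi := fun y => `|v y - v s|) st Psim).
- move=> x sx xt e e0; apply: filterS (left x sx xt e e0) => y.
  by rewrite distrC; have := tri y x; lra.
- move=> x sx xt; apply: filterS (right x sx xt) => y.
  by have := tri x y; lra.
Qed.

(** * The power inequality of Bihari *)

Section Powers.
Context {R : realType}.
Implicit Types x y p q : R.

(** The convex function [x^(-q)] lies above its tangents; with [r = y / x] this is
[r^(-q) >= 1 - q ln r >= 1 - q (r - 1)]. *)
Lemma powRN_tangent x y q : 0 < q -> 0 < x -> 0 < y ->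
  x `^ (- q) - q * x `^ (- q - 1) * (y - x) <= y `^ (- q).
Proof.
move=> q0 x0 y0; pose r := y / x.
have r0 : 0 < r by rewrite divr_gt0.
have yE : y = x * r by rewrite /r mulrC divfK// gt_eqF.
have -> : x `^ (- q - 1) = x `^ (- q) / x.
  by rewrite powRB ?powRr1 ?(ltW x0)// (gt_eqF x0) implybT.
have -> : x `^ (- q) - q * (x `^ (- q) / x) * (y - x) = x `^ (- q) * (1 - q * (r - 1)).
  by rewrite /r; set z := x `^ (- q); field; rewrite gt_eqF.
rewrite [in leRHS]yE powRM ?(ltW r0) ?(ltW x0)// ler_wpM2l ?powR_ge0//.
rewrite /powR gt_eqF//; apply: le_trans (expR_ge1Dx _).
have lnr : ln r <= r - 1.
  by rewrite -[r in ln r](subrKC 1 r) le_ln1Dx//; lra.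
nra.
Qed.

Lemma le_powRNV k x q : 0 < q -> 0 < k -> 0 < x -> k <= x `^ (- q) ->
  x <= k `^ (- q^-1).
Proof.
move=> q0 k0 x0 kx.
have -> : x = (x `^ (- q)) `^ (- q^-1).
  by rewrite -powRrM mulrNN divff ?gt_eqF// powRr1// ltW.
rewrite ![_ `^ (- q^-1)]powRN lef_pV2 ?posrE ?powR_gt0//.
by apply: ge0_ler_powR; rewrite ?nnegrE ?powR_ge0 ?invr_ge0 ?(ltW q0) ?(ltW k0).
Qed.

Lemma powR_superadditive x y p : 0 <= x -> 0 <= y -> 1 <= p ->
  x `^ p + y `^ p <= (x + y) `^ p.
Proof.
move=> x0 y0 p1.
have := addr_ge0 x0 y0; rewrite le_eqVlt => /predU1P[s0|s0].
  have [-> ->] : x = 0 /\ y = 0 by split; lra.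
  by rewrite addr0 powR0 ?addr0//; lra.
have part z : 0 <= z -> z <= x + y -> z `^ p <= z / (x + y) * (x + y) `^ p.
  rewrite le_eqVlt => /predU1P[<- _|z0 zs].
    by rewrite mul0r mul0r powR0//; lra.
  rewrite -[z in leLHS](divfK (lt0r_neq0 s0)); apply: ge1r_powRZ => //; last exact: ltW.
  by rewrite divr_gt0//= ler_pdivrMr// mul1r.
apply: (@le_trans _ _ (x / (x + y) * (x + y) `^ p + y / (x + y) * (x + y) `^ p)).
  by apply: lerD; apply: part => //; lra.
by rewrite -!mulrDl divff ?mul1r// gt_eqF.
Qed.

(** If [G' <= a G^(q+1)], then [G^(-q)] decreases at rate at most [q a]. Only one-sided
bounds on the increments of [G] are available, and the tangent inequality transfers
them from [G] to [- G^(-q)]. The lower bound [d] on [G] keeps the slope of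
[x^(-q)] bounded, which gives the continuity of [G^(-q)] from the left. *)
Lemma bihari (G a : R -> R) (q d T : R) : 0 < q -> 0 < d -> 0 <= T ->
  (forall x, 0 <= x -> x <= T -> d <= G x) ->
  (forall x, 0 < x -> x <= T -> forall e, 0 < e ->
     \forall y \near x^'-, `|G y - G x| <= e) ->
  (forall x, 0 <= x -> x < T -> forall e, 0 < e ->
     \forall y \near x^'+, G y - G x <= (a x * G x `^ (q + 1) + e) * (y - x)) ->
  (forall x, 0 <= x -> x <= T -> 0 <= a x) ->
  (@lebesgue_measure R).-integrable `[0, T] (EFin \o a) ->
  G 0 `^ (- q) - q * fine (\int[@lebesgue_measure R]_(x in `[0%R, T]) (a x)%:E)%E
    <= G T `^ (- q).
Proof.
move=> q0 d0 T0 Gd left right a0 ia.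
apply/ler_addgt0Pr => e e0.
have c0 : 0 < q + T + 1 by lra.
pose eta := e / (q + T + 1).
have eta0 : 0 < eta by rewrite divr_gt0.
have etaE : eta * (q + T + 1) = e by rewrite /eta divfK// gt_eqF.
have [Psi [Psim Psil Psib]] := vitali_caratheodory T0 eta0 a0 ia.
have G0 x : 0 <= x -> x <= T -> 0 < G x.
  by move=> ? ?; apply: lt_le_trans d0 _; exact: Gd.
have : - G T `^ (- q) - - G 0 `^ (- q) <= (q * Psi T + eta * T) - (q * Psi 0 + eta * 0).
  apply: (le_increment_local (phi := fun x => - G x `^ (- q))
     (Psi := fun x => q * Psi x + eta * x)) => //.
  - move=> x y _ xy _; have := Psim _ _ xy; nra.
  - move=> x x0 xT r r0.
    have M0 : 0 < q * d `^ (- q - 1) by rewrite mulr_gt0// powR_gt0.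
    near=> y.
    have yx : y < x by near: y; exact: nbhs_left_lt.
    have y0 : 0 < y by near: y; exact: nbhs_left_gt.
    have Gy := G0 y (ltW y0) (ltW (lt_le_trans yx xT)).
    have Gx := G0 x (ltW x0) xT.
    have := powRN_tangent q0 Gy Gx.
    have : `|G y - G x| <= r / (q * d `^ (- q - 1)).
      by near: y; apply: left => //; exact: divr_gt0.
    rewrite ler_pdivlMr// => h.
    have : G y `^ (- q - 1) <= d `^ (- q - 1).
      have -> : - q - 1 = - (q + 1) by ring.
      rewrite !powRN lef_pV2 ?posrE ?powR_gt0//.
      apply: ge0_ler_powR; rewrite ?nnegrE; [lra|lra|lra|].
      by apply: Gd; [exact: ltW|exact: ltW (lt_le_trans yx xT)].
    have := ler_norm (G x - G y); rewrite distrC.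
    have := normr_ge0 (G y - G x).
    have := powR_ge0 (G y) (- q - 1).
    move: h; set N := `|_|; set c := d `^ _; set g := G y `^ (- q - 1) => h1 h2 h3 h4 h5 h6.
    have : q * g * (G x - G y) <= q * g * N by rewrite ler_wpM2l// mulr_ge0// ltW.
    have : q * g * N <= N * (q * c) by rewrite mulrC ler_wpM2l// ler_wpM2l// ltW.
    lra.
  - move=> x x0 xT.
    have Gx := G0 x x0 (ltW xT).
    pose r := eta / (q * G x `^ (- q - 1)).
    have M0 : 0 < q * G x `^ (- q - 1) by rewrite mulr_gt0// powR_gt0.
    have r0 : 0 < r by rewrite divr_gt0.
    near=> y.
    have xy : x < y by near: y; exact: nbhs_right_gt.
    have yT : y < T by near: y; exact: nbhs_right_lt.
    have Gy := G0 y (le_trans x0 (ltW xy)) (ltW yT).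
    have := powRN_tangent q0 Gx Gy.
    have h1 : a x * (y - x) <= Psi y - Psi x by near: y; exact: Psil.
    have h2 : G y - G x <= (a x * G x `^ (q + 1) + r) * (y - x).
      by near: y; exact: right.
    have h3 : q * G x `^ (- q - 1) * (G y - G x) <=
        q * G x `^ (- q - 1) * ((a x * G x `^ (q + 1) + r) * (y - x)).
      by rewrite ler_wpM2l// ltW.
    have h4 : G x `^ (- q - 1) * G x `^ (q + 1) = 1.
      by rewrite -powRD ?(gt_eqF Gx) ?implybT// (_ : - q - 1 + (q + 1) = 0) ?powRr0//; ring.
    have h5 : q * G x `^ (- q - 1) * r = eta.
      by rewrite /r mulrC divfK// gt_eqF.
    have : q * G x `^ (- q - 1) * ((a x * G x `^ (q + 1) + r) * (y - x)) =
       q * (a x * (y - x)) + eta * (y - x).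
      move: h4 h5; move: (G x `^ (- q - 1)) (G x `^ (q + 1)) => g P h4 h5.
      have -> : q * g * ((a x * P + r) * (y - x)) =
        q * a x * (g * P) * (y - x) + q * g * r * (y - x) by ring.
      by rewrite h4 h5; ring.
    have : q * (a x * (y - x)) <= q * (Psi y - Psi x) by rewrite ler_wpM2l// ltW.
    lra.
have : q * (Psi T - Psi 0) <= q * (fine (\int[lebesgue_measure]_(x in `[0%R, T]) (a x)%:E)%E + eta).
  by rewrite ler_wpM2l// ltW.
set J := fine _.
lra.
Unshelve. all: by end_near. Qed.
End Powers.

(** * Consequences of the smallness condition *)

Section Threshold.
Context {R : realType}.

(** The strict inequality leaves room for a [w > 0] above [om]. Positivity of [w] keeps
[|v| + w] away from [0], where the negative power used in [bihari] is singular. The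
case of a zero integral, where the threshold is infinite, allows any [w]. *)
Lemma threshold_margin (om I0 : \bar R) (n q : R) : 0 < q -> 0 <= n ->
  (0 <= om)%E -> (0 <= I0)%E ->
  (om < ((q%:E * I0) `^ q^-1)^-1 - n%:E)%E ->
  I0 \is a fin_num /\
  exists w : R, [/\ 0 < w, (om <= w%:E)%E & q * fine I0 < (n + w) `^ (- q)].
Proof.
move=> q0 n0 om0; case: I0 => [J|_|//]; last first.
  rewrite gt0_muley ?lte_fin// poweRyr ?invey ?invr_eq0 ?gt_eqF// add0e => h.
  by have := le_lt_trans om0 h; rewrite lte_fin; lra.
rewrite lee_fin -EFinM poweR_EFin => J0 h; split => //=.
have [K0|K0] := eqVneq (q * J) 0.
  move: h; rewrite K0 powR0 ?invr_eq0 ?gt_eqF// inve0 => h.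
  have : om \is a fin_num by rewrite ge0_fin_numE// (lt_le_trans h)// leey.
  move=> /fineK omE; exists (fine om + 1); have := fine_ge0 om0 => ?; split.
  - lra.
  - by rewrite -[leLHS]omE lee_fin; lra.
  - by rewrite powR_gt0//; lra.
have Kp : 0 < q * J by rewrite lt0r K0 mulr_ge0// ltW.
have kp : 0 < (q * J) `^ q^-1 by rewrite powR_gt0.
move: h; rewrite inver gt_eqF//; set tau := _^-1 => h.
have tau0 : 0 < tau by rewrite invr_gt0.
have omf : om \is a fin_num by rewrite ge0_fin_numE// (lt_trans h)// ltry.
have omE := fineK omf; have := fine_ge0 om0 => f0.
move: h; rewrite -omE -EFinB lte_fin => h.
exists ((fine om + tau - n) / 2); split; [lra|by rewrite lee_fin; lra|].
have -> : q * J = tau `^ (- q).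
  rewrite (_ : tau = (q * J) `^ (- q^-1)); last by rewrite powRN.
  by rewrite -powRrM mulrNN mulVf ?gt_eqF// powRr1// ltW.
rewrite !powRN ltf_pV2 ?posrE ?powR_gt0//; last lra.
by apply: gt0_ltr_powR; rewrite ?nnegrE//; lra.
Qed.

(** Where [alpha t] or the norm of [U t] vanishes, the extended quotient in [omega] is
finite only if [beta t = 0], so that no case is lost. *)
Lemma omega_bound (X : normedModType R) (p : R) (alpha beta : R -> R)
    (U : R -> X -> X) (w t : R) : 0 < p -> 0 <= t -> 0 <= alpha t -> 0 <= beta t ->
  0 <= w -> (omega p alpha beta U <= w%:E)%E ->
  beta t <= alpha t * (w * opnorm (U t)) `^ p.
Proof.
move=> p0 t0 a0 b0 w0 h.
have N0 := opnorm_ge0 (U t).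
have : (((beta t)%:E / (alpha t)%:E) `^ p^-1 * (opnorm (U t))%:E^-1 <= w%:E)%E.
  apply: le_trans h; apply: ereal_sup_ubound; exists t => //=.
  by rewrite in_itv/= t0.
move: (beta t) (alpha t) (opnorm (U t)) b0 a0 N0 => b a N b0 a0 N0.
have p1 : 0 < p^-1 by rewrite invr_gt0.
move: b0; rewrite le_eqVlt => /predU1P[<- _|b0]; first by rewrite mulr_ge0// powR_ge0.
rewrite [a%:E^-1%E]inver; move: a0; rewrite le_eqVlt => /predU1P[<-|a0].
  rewrite eqxx gt0_muley ?lte_fin// poweRyr ?gt_eqF//.
  rewrite gt0_mulye ?leye_eq//; rewrite inver; case: ifPn => // Nn.
  by rewrite lte_fin invr_gt0 lt0r Nn.
rewrite gt_eqF// -EFinM poweR_EFin inver.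
have r0 : 0 < (b / a) `^ p^-1 by rewrite powR_gt0// divr_gt0.
case: ifPn => [_|Nn]; first by rewrite gt0_muley.
have {Nn}N0 : 0 < N by rewrite lt0r Nn.
rewrite -EFinM lee_fin ler_pdivrMr// => le1.
rewrite -ler_pdivrMl// mulrC.
have -> : b / a = ((b / a) `^ p^-1) `^ p.
  by rewrite -powRrM mulVf ?gt_eqF// powRr1// ltW// divr_gt0.
by apply: ge0_ler_powR; rewrite ?nnegrE; [exact: ltW|exact: ltW|rewrite mulr_ge0// ltW|].
Qed.

Lemma omega_ge0 (X : normedModType R) (p : R) (alpha beta : R -> R)
    (U : R -> X -> X) : (0 <= omega p alpha beta U)%E.
Proof.
apply: ereal_sup_ge; exists (((beta 0)%:E / (alpha 0)%:E) `^ p^-1 * (opnorm (U 0))%:E^-1)%E.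
  by exists 0 => //=; rewrite in_itv/= lexx.
by rewrite mule_ge0 ?poweR_ge0// inve_ge0 lee_fin opnorm_ge0.
Qed.
End Threshold.

(** * The linear flow and the weight *)

Section Weight.
Context {R : realType} {X : normedModType R}.

Lemma op_derives_near_lipschitz (I : set R) (A : R -> X -> X) t L :
  I t -> (forall s, I s -> homogeneous_bounded (A s)) -> homogeneous_bounded L ->
  op_derives_within I A t L -> \forall s \near t, I s -> forall x,
    `|A s x - A t x| <= (1 + opnorm L) * `|s - t| * `|x|.
Proof.
move=> It hA hL dA.
apply: filterS (op_derives_within_first_order It hA hL dA ltr01) => s hs Is x.
rewrite -[A s x - A t x](subrK ((s - t) *: L x)) !mulrDl.
apply: (le_trans (ler_normD _ _)); rewrite lerD ?hs//.
by rewrite normrZ mulrC mulrAC ler_wpM2r// le_opnorm.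
Qed.

Lemma opnorm_op_derives_continuous (I : set R) (A D : R -> X -> X) :
  (forall t, I t -> homogeneous_bounded (A t)) ->
  (forall t, I t -> homogeneous_bounded (D t)) ->
  (forall t, I t -> op_derives_within I A t (D t)) ->
  {within I, continuous (fun t => opnorm (A t))}.
Proof.
move=> hA hD dA; apply/subspace_continuousP => t It; apply/cvgrPdist_le => e e0.
have hl : \forall s \near t, I s ->
    `|opnorm (A s) - opnorm (A t)| <= (1 + opnorm (D t)) * `|s - t|.
  apply: filterS (op_derives_near_lipschitz It hA (hD t It) (dA t It)) => s hs Is.
  have {}hs := hs Is.
  have K0 : 0 <= (1 + opnorm (D t)) * `|s - t|.
    by rewrite mulr_ge0// addr_ge0// opnorm_ge0.
  rewrite ler_distlC; apply/andP; split.
    rewrite lerBlDr; apply: opnorm_le; first by rewrite addr_ge0// opnorm_ge0.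
    move=> x; rewrite mulrDl -[A s x](subrK (A t x)) addrC.
    apply: (le_trans (ler_normD _ _)); rewrite lerD//; exact: le_opnorm (hA t It).
  apply: opnorm_le; first by rewrite addr_ge0// opnorm_ge0.
  move=> x; rewrite mulrDl -[A t x](subrK (A s x)) addrC.
  apply: (le_trans (ler_normD _ _)); rewrite lerD//; first exact: le_opnorm (hA s Is).
  by rewrite distrC.
have := near_lipschitz_continuous (u := fun s => opnorm (A s) : R^o) hl e0.
by rewrite near_withinE; apply: filterS => s hs Is /=; rewrite distrC; exact: hs.
Qed.

Lemma measurable_halfline (g : R -> R) :
  (forall T : R, 0 <= T -> measurable_fun `[0, T] g) ->
  measurable_fun `[(0 : R), +oo[ g.
Proof.
move=> h; have -> : `[(0 : R), +oo[%classic = \bigcup_n `[(0 : R), n%:R]%classic.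
  apply/seteqP; split=> [x /=|x [n _]] /=; rewrite !in_itv/=.
    rewrite andbT => x0; exists (Num.truncn x).+1 => //=.
    by rewrite in_itv/= x0 ltW// truncnS_gt.
  by case/andP => ->.
by apply/measurable_fun_bigcup => // n; exact: h.
Qed.
End Weight.

Lemma telescope3 (V : zmodType) (P Q S L T B : V) :
  P - Q - (L - T) = (P - S + B) + (T - B) + (S - Q - L).
Proof.
rewrite [P - S + B]addrC [B + _ + _]addrC subrKA [T + _]addrC [P - S + T]addrAC.
by rewrite -[S - Q - L]addrA subrKA opprB -[LHS]addrA [- Q + _]addrCA [LHS]addrA.
Qed.

Lemma subrBB (V : zmodType) (a b p q : V) : a - p - (b - q) = a - b - (p - q).
Proof. by rewrite !opprB addrACA [RHS]addrACA [- p - b]addrC. Qed.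

Section Evolution.
Context {R : realType} {X : normedModType R} (F : R -> X -> X)
  (U Uinv : R -> {linear X -> X}).
Hypothesis hFdiff : forall t : R, 0 <= t -> differentiable (F t) (0 : X).
Hypothesis hU : is_evolution (lin0 F) U Uinv.

Lemma homogeneous_bounded_lin0 t : 0 <= t -> homogeneous_bounded (lin0 F t).
Proof.
by move=> t0; apply: homogeneous_bounded_linear; apply: diff_continuous; exact: hFdiff.
Qed.

Lemma homogeneous_bounded_U t : 0 <= t -> homogeneous_bounded (U t).
Proof.
by move=> t0; have [h _ _ _ _] := hU; apply: homogeneous_bounded_linear; case: (h t t0).
Qed.

Lemma homogeneous_bounded_Uinv t : 0 <= t -> homogeneous_bounded (Uinv t).
Proof.
by move=> t0; have [h _ _ _ _] := hU; apply: homogeneous_bounded_linear; case: (h t t0).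
Qed.

(** The coefficient [a] of the differential inequality for the pulled-back solution. *)
Definition weight (p : R) (alpha : R -> R) (t : R) : R :=
  opnorm (Uinv t) * opnorm (U t) `^ p * alpha t.

Lemma weight_ge0 p alpha t : 0 <= alpha t -> 0 <= weight p alpha t.
Proof. by move=> a0; rewrite !mulr_ge0// ?powR_ge0// opnorm_ge0. Qed.

Lemma opnorm_U_continuous : {within `[0, +oo[, continuous (fun t => opnorm (U t))}.
Proof.
have ge0 t : `[0, +oo[%classic t -> 0 <= t by rewrite /= in_itv/= andbT.
have [_ _ _ dU _] := hU.
apply: (opnorm_op_derives_continuous (A := fun t => U t : X -> X)
  (D := fun t x => lin0 F t (U t x))) => t /ge0 t0.
- exact: homogeneous_bounded_U.
- by apply: homogeneous_bounded_comp; [exact: homogeneous_bounded_lin0|exact: homogeneous_bounded_U].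
- exact: dU.
Qed.

Lemma opnorm_Uinv_continuous : {within `[0, +oo[, continuous (fun t => opnorm (Uinv t))}.
Proof.
have ge0 t : `[0, +oo[%classic t -> 0 <= t by rewrite /= in_itv/= andbT.
have [_ _ _ _ dV] := hU.
apply: (opnorm_op_derives_continuous (A := fun t => Uinv t : X -> X)
  (D := fun t x => - Uinv t (lin0 F t x))) => t /ge0 t0.
- exact: homogeneous_bounded_Uinv.
- apply: homogeneous_boundedN.
  by apply: homogeneous_bounded_comp; [exact: homogeneous_bounded_Uinv|exact: homogeneous_bounded_lin0].
- exact: dV.
Qed.

Lemma measurable_weight p alpha : L1loc alpha ->
  measurable_fun `[(0 : R), +oo[ (weight p alpha).
Proof.
move=> ia; have mI : measurable (`[(0 : R), +oo[%classic : set R) by exact: measurable_itv.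
apply: measurable_funM; first apply: measurable_funM.
- exact: (subspace_continuous_measurable_fun mI opnorm_Uinv_continuous).
- apply: (measurableT_comp (measurable_powR p)).
  exact: (subspace_continuous_measurable_fun mI opnorm_U_continuous).
- apply: measurable_halfline => T T0; apply/measurable_EFinP.
  by apply: measurable_int (ia T T0).
Qed.

Lemma integrable_weight p alpha (T : R) : L1loc alpha ->
  (forall t : R, 0 <= t -> 0 <= alpha t) ->
  (\int[@lebesgue_measure R]_(x in `[0%R, +oo[) (weight p alpha x)%:E)%E \is a fin_num ->
  0 <= T ->
  (@lebesgue_measure R).-integrable `[0, T] (EFin \o weight p alpha) /\
  fine (\int[@lebesgue_measure R]_(x in `[0%R, T]) (weight p alpha x)%:E)%E <=
  fine (\int[@lebesgue_measure R]_(x in `[0%R, +oo[) (weight p alpha x)%:E)%E.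
Proof.
move=> ia a0 fI T0.
have mw := measurable_weight p ia.
have sub : `[0, T]%classic `<=` (`[(0 : R), +oo[%classic : set R).
  by move=> x /=; rewrite !in_itv/= => /andP[->].
have mT : measurable (`[0, T]%classic : set R) by exact: measurable_itv.
have mI : measurable (`[(0 : R), +oo[%classic : set R) by exact: measurable_itv.
have w0 x : `[0, +oo[%classic x -> (0 <= (weight p alpha x)%:E)%E.
  by rewrite /= in_itv/= andbT => x0; rewrite lee_fin weight_ge0// a0.
have le : (\int[@lebesgue_measure R]_(x in `[0%R, T]) (weight p alpha x)%:E <=
  \int[@lebesgue_measure R]_(x in `[0%R, +oo[) (weight p alpha x)%:E)%E.
  by apply: ge0_subset_integral => //; exact/measurable_EFinP.
have i0 : (0 <= \int[@lebesgue_measure R]_(x in `[0%R, T]) (weight p alpha x)%:E)%E.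
  by apply: integral_ge0 => x /sub; exact: w0.
have fT : (\int[@lebesgue_measure R]_(x in `[0%R, T]) (weight p alpha x)%:E)%E \is a fin_num.
  by rewrite ge0_fin_numE// (le_lt_trans le)// ltey_eq fI.
split; last exact: fine_le.
apply/integrableP; split.
  by apply/measurable_EFinP; exact: measurable_funS mw.
have lty : (\int[@lebesgue_measure R]_(x in `[0%R, T]) (weight p alpha x)%:E < +oo)%E.
  by rewrite ltey_eq fT.
apply: le_lt_trans lty; rewrite le_eqVlt; apply/orP; left; apply/eqP.
apply: eq_integral => x /set_mem xT.
by rewrite gee0_abs//; exact: w0 (sub x xT).
Qed.

(** Product rule for [Uinv s (u s)]: the derivative [- Uinv B] of the operator cancels
the linear part of [u']. *)
Lemma first_order_Uinv_apply (I : set R) (u : R -> X) t (l : X) : I `<=` `[0, +oo[ -> I t ->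
  first_order I u t l ->
  first_order I (fun s => Uinv s (u s)) t (Uinv t (l - lin0 F t (u t))).
Proof.
move=> I0 It du e e0.
have ge0 s : I s -> 0 <= s by move/I0; rewrite /= in_itv/= andbT.
have t0 := ge0 t It; have [_ _ _ _ dV] := hU.
have hV := homogeneous_bounded_Uinv t0.
have hB := homogeneous_bounded_lin0 t0.
have hVB := homogeneous_bounded_comp hV hB.
pose e1 := e / 3 / (`|u t| + 1).
pose e2 := e / 3 / (opnorm (fun x => Uinv t (lin0 F t x)) + 1).
pose e3 := e / 3 / (opnorm (Uinv t) + 1).
have n1 : 0 < `|u t| + 1 by rewrite ltr_wpDl.
have n2 : 0 < opnorm (fun x => Uinv t (lin0 F t x)) + 1 by rewrite ltr_wpDl ?opnorm_ge0.
have n3 : 0 < opnorm (Uinv t) + 1 by rewrite ltr_wpDl ?opnorm_ge0.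
have e10 : 0 < e1 by rewrite !divr_gt0.
have e20 : 0 < e2 by rewrite !divr_gt0.
have e30 : 0 < e3 by rewrite !divr_gt0.
have hVs s : `[0, +oo[%classic s -> homogeneous_bounded (Uinv s).
  by rewrite /= in_itv/= andbT; exact: homogeneous_bounded_Uinv.
have h1n := op_derives_within_first_order (A := fun s => Uinv s : X -> X) (I0 t It)
  hVs (homogeneous_boundedN hVB) (dV t t0) e10.
have cu := near_lipschitz_continuous (first_order_near_lipschitz du ltr01).
near=> s => Is.
have h1 : `|Uinv s (u s) - Uinv t (u s) - (s - t) *: - Uinv t (lin0 F t (u s))| <=
    e1 * `|s - t| * `|u s|.
  have Is0 := I0 s Is; move: (u s) => x; move: Is0 x; near: s; exact: h1n.
have h2 : `|u s - u t| <= e2 by move: Is; near: s; exact: cu.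
have h3 : `|u s - u t| <= 1 by move: Is; near: s; exact: cu.
have h4 : `|u s - u t - (s - t) *: l| <= e3 * `|s - t| by move: Is; near: s; exact: du.
have us : `|u s| <= `|u t| + 1.
  by rewrite -[u s](subrK (u t)) addrC (le_trans (ler_normD _ _))// lerD2l.
have -> : Uinv s (u s) - Uinv t (u t) - (s - t) *: Uinv t (l - lin0 F t (u t)) =
  (Uinv s (u s) - Uinv t (u s) - (s - t) *: - Uinv t (lin0 F t (u s)))
  + (s - t) *: - Uinv t (lin0 F t (u s - u t))
  + Uinv t (u s - u t - (s - t) *: l).
  have -> : lin0 F t (u s - u t) = lin0 F t (u s) - lin0 F t (u t) by rewrite /lin0 linearB.
  move: (lin0 F t (u s)) (lin0 F t (u t)) => bs bt.
  have lB x y : Uinv t (x - y) = Uinv t x - Uinv t y by rewrite linearB.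
  have lZ x : Uinv t ((s - t) *: x) = (s - t) *: Uinv t x by rewrite linearZ.
  rewrite !lB lZ !scalerN opprK !scalerBr [in RHS]opprB; exact: telescope3.
apply: (le_trans (ler_normD _ _)); apply: (le_trans (lerD (ler_normD _ _) (lexx _))).
have -> : e * `|s - t| = e / 3 * `|s - t| + e / 3 * `|s - t| + e / 3 * `|s - t| by field.
(* The three summands of the remainder are each at most [e / 3 * |s - t|]. *)
have third (c k x y : R) : 0 < k -> 0 <= c -> c <= k -> 0 <= y -> x <= c * (e / 3 / k * y) -> x <= e / 3 * y.
  move=> k0 c0 ck y0 hx; apply: (le_trans hx).
  have -> : e / 3 * y = k * (e / 3 / k * y) by field; rewrite gt_eqF.
  by rewrite ler_wpM2r// mulr_ge0// !divr_ge0// ltW.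
apply: lerD; first apply: lerD.
- by apply: third n1 _ us _ _ => //; rewrite mulrC.
- have c2 : opnorm (fun x => Uinv t (lin0 F t x)) <=
    opnorm (fun x => Uinv t (lin0 F t x)) + 1 by rewrite lerDl.
  apply: (third _ _ _ _ n2 (opnorm_ge0 _) c2 (normr_ge0 _)).
  rewrite normrZ normrN [leLHS]mulrC mulrA ler_wpM2r//.
  by apply: (le_trans (le_opnorm _ hVB)); rewrite ler_wpM2l ?opnorm_ge0.
- have c3 : opnorm (Uinv t) <= opnorm (Uinv t) + 1 by rewrite lerDl.
  apply: (third _ _ _ _ n3 (opnorm_ge0 _) c3 (normr_ge0 _)).
  by apply: (le_trans (le_opnorm _ hV)); rewrite ler_wpM2l ?opnorm_ge0.
Unshelve. all: by end_near. Qed.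

End Evolution.

(** * Solutions on subintervals *)

Lemma itv_sub0 {R : realType} (T : R) : `[0, T[%classic `<=` `[0, +oo[%classic.
Proof. by move=> x /=; rewrite !in_itv/= => /andP[->]. Qed.

Section Solutions.
Context {R : realType} {X : normedModType R} (F : R -> X -> X) (f : R -> X).
Hypothesis hFcont :
  {within `[0, +oo[ `*` [set: X], continuous (fun z : R * X => F z.1 z.2)}.
Hypothesis hfcont : {within `[0, +oo[, continuous f}.
Implicit Types (I J : set R) (u z : R -> X).

Definition velocity u t := F t (u t) + f t.

Definition solves I u := forall t, I t -> first_order I u t (velocity u t).

Lemma velocity_continuous I u t : I `<=` `[0, +oo[ -> I t ->
  (forall e : R, 0 < e -> \forall s \near t, I s -> `|u s - u t| <= e) ->
  velocity u s @[s --> within I (nbhs t)] --> velocity u t.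
Proof.
move=> I0 It cu.
have cu' : u s @[s --> within I (nbhs t)] --> u t.
  apply/cvgrPdist_le => e e0; rewrite near_withinE.
  by apply: filterS (cu e e0) => s hs Is; rewrite distrC; exact: hs.
have ct : id s @[s --> within I (nbhs t)] --> t by apply: cvg_within.
apply: cvgD.
  have /subspace_continuousP/(_ (t, u t)) := hFcont.
  move=> /(_ (conj (I0 t It) Logic.I)) hF.
  apply: (@cvg_comp _ _ _ (fun s => (s, u s)) (fun z : R * X => F z.1 z.2) _ _ _ _ hF) => P hP.
  have cp : (s, u s) @[s --> within I (nbhs t)] --> (t, u t) by exact: cvg_pair ct cu'.
  have H : within I (nbhs t)
      (fun s => (`[0, +oo[ `*` [set: X]) (s, u s) -> P (s, u s)) := cp _ hP.
  change (within I (nbhs t) (fun s => P (s, u s))).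
  move: H; rewrite -!nearE !near_withinE; apply: filterS => s hs Is.
  exact: hs Is (conj (I0 s Is) Logic.I).
have /subspace_continuousP/(_ t (I0 t It)) hf := hfcont.
move=> P /hf H; change (within I (nbhs t) (fun s => P (f s))).
have {}H : within `[0, +oo[ (nbhs t) (fun s => P (f s)) := H.
by move: H; rewrite -!nearE !near_withinE; apply: filterS => s hs /I0.
Qed.

Lemma solves_continuous I u : solves I u -> forall t, I t ->
  forall e : R, 0 < e -> \forall s \near t, I s -> `|u s - u t| <= e.
Proof.
move=> su t It; apply: near_lipschitz_continuous.
exact: first_order_near_lipschitz (su t It) _ ltr01.
Qed.

(** Continuity of the derivative is automatic: a solution is continuous, and the vector
field is jointly continuous. *)
Lemma solutionP t0 x0 I u : I `<=` `[0, +oo[ ->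
  solution F f t0 x0 I u <-> u t0 = x0 /\ solves I u.
Proof.
move=> I0; split=> [[ut0 du _]|[ut0 du]].
  by split=> // t It; apply/derives_withinP; exact: du.
split=> //; first by move=> t It; apply/derives_withinP; exact: du.
apply/subspace_continuousP => t It; apply: velocity_continuous => //.
exact: solves_continuous.
Qed.

(** Being a solution at [t] depends only on the values near [t]; this serves both to
restrict solutions and to glue them. *)
Lemma first_order_local I J u z t : I t ->
  first_order J z t (velocity z t) ->
  (\forall s \near t, I s -> J s /\ u s = z s) -> first_order I u t (velocity u t).
Proof.
move=> It dz near_t e e0; have [_ uz] := nbhs_singleton near_t It.
apply: filterS2 near_t (dz e e0) => s hs hz Is.
by have [Js us] := hs Is; rewrite /velocity us uz; exact: hz.
Qed.

Lemma solves_local I u :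
  (forall t, I t -> exists J, exists z, [/\ solves J z, J t &
     \forall s \near t, I s -> J s /\ u s = z s]) -> solves I u.
Proof.
move=> h t It; have [J [z [sz Jt near_t]]] := h t It.
exact: first_order_local It (sz t Jt) near_t.
Qed.

Lemma solves_sub I J u : J `<=` I -> solves I u -> solves J u.
Proof.
move=> JI su; apply: solves_local => t Jt; exists I, u; split => //; first exact: JI.
by near=> s => Js; split=> //; exact: JI.
Unshelve. all: by end_near. Qed.
End Solutions.

(** * The a priori bound *)

Section Dynamics.
Context {R : realType} {X : completeNormedModType R} (F : R -> X -> X)
  (f : R -> X) (alpha beta : R -> R) (p : R) (u0 : X)
  (U Uinv : R -> {linear X -> X}) (w : R).
Hypothesis hp : 1 < p.
Hypothesis hFcont :
  {within `[0, +oo[ `*` [set: X], continuous (fun z : R * X => F z.1 z.2)}.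
Hypothesis hfcont : {within `[0, +oo[, continuous f}.
Hypothesis hFdiff : forall t : R, 0 <= t -> differentiable (F t) (0 : X).
Hypothesis halpha0 : forall t : R, 0 <= t -> 0 <= alpha t.
Hypothesis halpha : L1loc alpha.
Hypothesis hF : forall (t : R) (x : X), 0 <= t ->
  `|F t x - lin0 F t x| <= alpha t * `|x| `^ p.
Hypothesis hf : forall t : R, 0 <= t -> `|f t| <= beta t.
Hypothesis hU : is_evolution (lin0 F) U Uinv.
Hypothesis w0 : 0 < w.
Hypothesis hbeta : forall t : R, 0 <= t ->
  beta t <= alpha t * (w * opnorm (U t)) `^ p.
Let a := weight U Uinv p alpha.
Let I0 := (\int[@lebesgue_measure R]_(x in `[0%R, +oo[) (a x)%:E)%E.
Hypothesis hI0 : I0 \is a fin_num.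
Hypothesis hmargin : (p - 1) * fine I0 < (`|u0| + w) `^ (- (p - 1)).

(** The limit at infinity of the solution of [y' = a y^p] with [y 0 = |u0| + w]. *)
Definition growth_const : R := ((`|u0| + w) `^ (- (p - 1)) - (p - 1) * fine I0) `^ (- (p - 1)^-1).

Lemma growth_const_gt0 : 0 < growth_const.
Proof. by apply: powR_gt0; rewrite subr_gt0. Qed.

Lemma U_Uinv t x : 0 <= t -> U t (Uinv t x) = x.
Proof. by move=> t0; have [_ _ h _ _] := hU; have [_ ->] := h t t0. Qed.

Lemma norm_le_pullback t x : 0 <= t -> `|x| <= opnorm (U t) * `|Uinv t x|.
Proof.
move=> t0; rewrite -{1}(U_Uinv x t0).
exact: le_opnorm (homogeneous_bounded_U hU t0).
Qed.

(** The step that uses the structure of the equation: since [|x| <= |U| |Uinv x|], both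
the nonlinearity and the forcing are estimated by powers of [|Uinv x|] and [w] with
the same coefficient, and superadditivity of the power merges them. *)
Lemma norm_perturbation t x : 0 <= t ->
  `|Uinv t (F t x + f t - lin0 F t x)| <= a t * (`|Uinv t x| + w) `^ p.
Proof.
move=> t0; have a0 := halpha0 t0; have p0 : 0 <= p by move: hp; lra.
have N0 := opnorm_ge0 (U t).
apply: (le_trans (le_opnorm _ (homogeneous_bounded_Uinv hU t0))).
rewrite /a /weight -!mulrA ler_wpM2l ?opnorm_ge0//.
rewrite addrAC; apply: (le_trans (ler_normD _ _)).
apply: (le_trans (lerD (hF x t0) (le_trans (hf t0) (hbeta t0)))).
rewrite -mulrDr mulrCA ler_wpM2l//.
apply: (@le_trans _ _ ((opnorm (U t) * `|Uinv t x|) `^ p + (w * opnorm (U t)) `^ p)).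
  rewrite lerD2r; apply: ge0_ler_powR; rewrite ?nnegrE// ?mulr_ge0//.
  exact: norm_le_pullback.
rewrite (mulrC w) !powRM ?(ltW w0)// -mulrDr ler_wpM2l ?powR_ge0//.
by apply: powR_superadditive => //; exact: ltW.
Qed.

Lemma pullback_slope (I : set R) u t e : I `<=` `[0, +oo[ -> I t ->
  solves F f I u -> 0 < e -> \forall s \near t, I s ->
  `|Uinv s (u s) - Uinv t (u t)| <= (a t * (`|Uinv t (u t)| + w) `^ p + e) * `|s - t|.
Proof.
move=> II It su e0.
have t0 : 0 <= t by have := II t It; rewrite /= in_itv/= andbT.
have dv := first_order_Uinv_apply hFdiff hU II It (su t It).
apply: filterS (first_order_near_lipschitz dv e0) => s hs Is.
apply: (le_trans (hs Is)); rewrite ler_wpM2r// lerD2r.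
exact: norm_perturbation.
Qed.

(** [bihari] applied to [|v| + w], where [v] is the pulled-back solution. *)
Lemma pullback_bound (T : R) u t : u 0 = u0 -> solves F f `[0, T[ u ->
  0 <= t -> t < T -> `|Uinv t (u t)| + w <= growth_const.
Proof.
move=> u00 su t0 tT.
pose v s := Uinv s (u s); pose G s := `|v s| + w.
have q0 : 0 < p - 1 by move: hp; lra.
have [ia leI] := integrable_weight hFdiff hU halpha halpha0 hI0 t0.
have inT (s : R) : 0 <= s -> s <= t -> `[0, T[%classic s.
  by move=> s0 st; rewrite /= in_itv/= s0 (le_lt_trans st).
have GG x y : `|G y - G x| <= `|v y - v x|.
  by rewrite /G opprD addrACA subrr addr0 ler_dist_dist.
have G0 : G 0 = `|u0| + w.
  rewrite /G /v u00; congr (`|_| + _).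
  by have [_ h _ _ _] := hU; have [_ ->] := h u0.
have main : G 0 `^ (- (p - 1)) - (p - 1) * fine (\int[lebesgue_measure]_(x in `[0%R, t]) (a x)%:E)%E
    <= G t `^ (- (p - 1)).
  apply: (@bihari _ G a (p - 1) w) => //.
  - by move=> x _ _; rewrite /G lerDr.
  - move=> x x0 xt e e0.
    have hv := near_lipschitz_continuous (pullback_slope (@itv_sub0 R T) (inT x (ltW x0) xt) su ltr01) e0.
    near=> y.
    have yx : y < x by near: y; exact: nbhs_left_lt.
    have y0 : 0 < y by near: y; exact: nbhs_left_gt.
    apply: (le_trans (GG _ _)).
    have := inT y (ltW y0) (ltW (lt_le_trans yx xt)).
    by near: y; apply: cvg_within; exact: hv.
  - move=> x x0 xt e e0; rewrite subrK.
    have hv := pullback_slope (@itv_sub0 R T) (inT x x0 (ltW xt)) su e0.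
    near=> y.
    have xy : x < y by near: y; exact: nbhs_right_gt.
    have yt : y < t by near: y; exact: nbhs_right_lt.
    apply: (le_trans (ler_norm _)); apply: (le_trans (GG _ _)).
    rewrite -[y - x]gtr0_norm ?subr_gt0//.
    have := inT y (le_trans x0 (ltW xy)) (ltW yt).
    by near: y; apply: cvg_within; exact: hv.
  - by move=> x x0 _; rewrite weight_ge0// halpha0.
have kap : 0 < (`|u0| + w) `^ (- (p - 1)) - (p - 1) * fine I0 by rewrite subr_gt0.
have Gt : 0 < G t by rewrite /G ltr_wpDl.
apply: (le_powRNV q0 kap Gt).
apply: le_trans _ main; rewrite G0 lerD2l lerN2 ler_wpM2l// ltW//.
Unshelve. all: by end_near. Qed.

Lemma solution_bound (T : R) u t : u 0 = u0 -> solves F f `[0, T[ u ->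
  0 <= t -> t < T -> `|u t| <= growth_const * opnorm (U t).
Proof.
move=> u00 su t0 tT; apply: (le_trans (norm_le_pullback _ t0)).
rewrite mulrC ler_wpM2r ?opnorm_ge0//.
by have := pullback_bound u00 su t0 tT; move: w0; lra.
Qed.

(** * Uniqueness and continuation *)

Section Continuation.
Variable r : \bar R.
Hypothesis hr : forall t : R, 0 <= t -> ((growth_const * opnorm (U t))%:E < r)%E.
Hypothesis hls : locally_solvable F f r.

(** The a priori bound keeps a solution in the ball of radius [r], so that local
uniqueness is available at every time that it reaches. *)
Lemma solution_unique (T1 T2 t : R) (u1 u2 : R -> X) : u1 0 = u0 -> u2 0 = u0 ->
  solves F f `[0, T1[ u1 -> solves F f `[0, T2[ u2 ->
  0 <= t -> t < T1 -> t < T2 -> u1 t = u2 t.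
Proof.
move=> u10 u20 s1 s2 t0 t1 t2.
have inT (T s : R) : 0 <= s -> s < T -> `[0, T[%classic s by move=> s0 sT; rewrite /= in_itv/= s0.
have sub (T x : R) : 0 <= x -> `[x, T[%classic `<=` `[0, T[%classic.
  by move=> x0 z /=; rewrite !in_itv/= => /andP[xz ->]; rewrite (le_trans x0).
apply: (real_induction (P := fun s => u1 s = u2 s) t0); first by rewrite u10.
- move=> x x0 xt /(_ x x0 (lexx x)) e12.
  have x1 := lt_trans xt t1; have x2 := lt_trans xt t2.
  have hx : (`|u1 x|%:E < r)%E.
    by apply: le_lt_trans (hr x0); rewrite lee_fin; exact: solution_bound s1 _ _.
  have [T [z [T0 _ uniq]]] := hls x0 hx.
  have agree T' v : x < T' -> solves F f `[0, T'[ v -> v x = u1 x ->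
      forall y, x <= y -> y < x + T -> y < T' -> v y = z y.
    move=> xT' sv vx y xy yT yT'.
    have T'E : x + (T' - x) = T' by rewrite addrC subrK.
    apply: (uniq (T' - x)); rewrite ?subr_gt0 ?T'E//.
    apply/solutionP => //; first by move=> z' /(sub T' x x0); exact: itv_sub0.
    by split=> //; apply: solves_sub sv; exact: sub.
  near=> y.
  have xy : x <= y by apply: ltW; near: y; exact: nbhs_right_gt.
  have yt : y < t by near: y; exact: nbhs_right_lt.
  have yT : y < x + T by near: y; apply: nbhs_right_lt; rewrite ltrDl.
  rewrite (agree T1 u1 x1 s1 erefl y xy yT (lt_trans yt t1)).
  by rewrite (agree T2 u2 x2 s2 (esym e12) y xy yT (lt_trans yt t2)).
- move=> x x0 xt e12; apply/eqP; rewrite -subr_eq0 -normr_le0; apply/ler_addgt0Pr => e e0.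
  rewrite add0r; have e2 : 0 < e / 2 by rewrite divr_gt0.
  have c1 := solves_continuous s1 (inT T1 x (ltW x0) (le_lt_trans xt t1)) e2.
  have c2 := solves_continuous s2 (inT T2 x (ltW x0) (le_lt_trans xt t2)) e2.
  have : \forall y \near x^'-, `|u1 x - u2 x| <= e.
    near=> y.
    have yx : y < x by near: y; exact: nbhs_left_lt.
    have y0 : 0 < y by near: y; exact: nbhs_left_gt.
    have h1 : `|u1 y - u1 x| <= e / 2.
      have := inT T1 y (ltW y0) (lt_trans yx (le_lt_trans xt t1)).
      by near: y; apply: cvg_within; exact: c1.
    have h2 : `|u2 y - u2 x| <= e / 2.
      have := inT T2 y (ltW y0) (lt_trans yx (le_lt_trans xt t2)).
      by near: y; apply: cvg_within; exact: c2.
    rewrite (splitr e); apply: le_trans (lerD h1 h2).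
    by rewrite [`|u1 y - _|]distrC (e12 y (ltW y0) yx) ler_distD.
  by move=> H; have [] := filter_ex H.
Unshelve. all: by end_near. Qed.

(** The increments of [v] are dominated by those of a nondecreasing function [Phi] which
is bounded up to [T], and such a function has a limit from the left. *)
Lemma pullback_cauchy (T : R) (u : R -> X) : 0 < T -> u 0 = u0 -> solves F f `[0, T[ u ->
  cvg (Uinv s (u s) @[s --> T^'-]).
Proof.
move=> T0 u00 su; pose v s := Uinv s (u s).
have inT (s : R) : 0 <= s -> s < T -> `[0, T[%classic s by move=> s0 sT; rewrite /= in_itv/= s0.
have [ia _] := integrable_weight hFdiff hU halpha halpha0 hI0 (ltW T0).
have a0 x : 0 <= x -> x <= T -> 0 <= a x by move=> x0 _; rewrite weight_ge0// halpha0.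
have [Psi [Psim Psil _]] := vitali_caratheodory (ltW T0) ltr01 a0 ia.
pose Phi s := growth_const `^ p * Psi s + s.
have Phim (x y : R) : x <= y -> Phi x <= Phi y.
  by move=> xy; rewrite lerD// ler_wpM2l ?powR_ge0// Psim.
have vPhi (s t : R) : 0 <= s -> s <= t -> t < T -> `|v t - v s| <= Phi t - Phi s.
  move=> s0 st tT; apply: norm_increment => //.
  - by move=> x y _ xy _; exact: Phim.
  - move=> x sx xt e e0.
    have x0 := le_lt_trans s0 sx; have xT := le_lt_trans xt tT.
    have hv := near_lipschitz_continuous
      (pullback_slope (@itv_sub0 R T) (inT x (ltW x0) xT) su ltr01) e0.
    near=> y.
    have yx : y < x by near: y; exact: nbhs_left_lt.
    have y0 : 0 < y by near: y; exact: nbhs_left_gt.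
    have := inT y (ltW y0) (lt_trans yx xT).
    by near: y; apply: cvg_within; exact: hv.
  - move=> x sx xt.
    have x0 := le_trans s0 sx; have xT := lt_trans xt tT.
    have hv := pullback_slope (@itv_sub0 R T) (inT x x0 xT) su ltr01.
    near=> y.
    have xy : x < y by near: y; exact: nbhs_right_gt.
    have yt : y < t by near: y; exact: nbhs_right_lt.
    have h1 : `|v y - v x| <= (a x * (`|v x| + w) `^ p + 1) * (y - x).
      rewrite -[y - x]gtr0_norm ?subr_gt0//.
      have := inT y (le_trans x0 (ltW xy)) (lt_trans yt tT).
      by near: y; apply: cvg_within; exact: hv.
    have h2 : a x * (y - x) <= Psi y - Psi x by near: y; exact: Psil.
    have h3 : (`|v x| + w) `^ p <= growth_const `^ p.
      apply: ge0_ler_powR; rewrite ?nnegrE.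
      + by move: hp; lra.
      + by rewrite addr_ge0// ltW.
      + exact: ltW growth_const_gt0.
      + exact: pullback_bound su _ _.
    have h4 : (`|v x| + w) `^ p * (a x * (y - x)) <= growth_const `^ p * (Psi y - Psi x).
      apply: ler_pM => //; rewrite ?powR_ge0// mulr_ge0 ?subr_ge0 ?(ltW xy)// a0// ltW//.
    apply: (le_trans h1); rewrite /Phi; move: h4.
    set A := _ `^ p; set B := growth_const `^ p; lra.
have supPhi : has_sup [set Phi s | s in `[0, T[].
  split; first by exists (Phi 0), 0 => //=; rewrite in_itv/= lexx.
  by exists (Phi T) => y [s /=]; rewrite in_itv/= => /andP[_ sT] <-; rewrite Phim// ltW.
suff cex : cauchy_ex (v s @[s --> T^'-]) by apply: cauchy_cvg; exact: cauchy_exP cex.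
move=> e e0.
have [_ [s /= + <-] he] := sup_adherent e0 supPhi; rewrite in_itv/= => /andP[s0 sT].
exists (v s); apply: (_ : \forall t \near T^'-, ball (v s) e (v t)); near=> t.
have st : s < t by near: t; exact: nbhs_left_gt.
have tT : t < T by near: t; exact: nbhs_left_lt.
rewrite -ball_normE/= distrC; apply: le_lt_trans (vPhi s t s0 (ltW st) tT) _.
have : Phi t <= sup [set Phi s | s in `[0, T[].
  apply: ub_le_sup; first by case: supPhi.
  by exists t => //=; rewrite in_itv/= tT (le_trans s0 (ltW st)).
lra.
Unshelve. all: by end_near. Qed.

(** The solution is continued by its limit at [T], then by the local solution started
there. The delicate point is the derivative at [T] from the left: it exists because
the derivative before [T] converges, by the mean value inequality applied to
[z x - x *: l]. *)
Lemma solution_extends (T : R) (u : R -> X) : 0 < T -> u 0 = u0 ->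
  solves F f `[0, T[ u -> exists d, exists z,
  [/\ 0 < d, z 0 = u0 & solves F f `[0, T + d[ z].
Proof.
move=> T0 u00 su; pose v s := Uinv s (u s).
have inT (s : R) : 0 <= s -> s < T -> `[0, T[%classic s.
  by move=> s0 sT; rewrite /= in_itv/= s0.
have /cvg_ex[y cy] := pullback_cauchy T0 u00 su.
pose xs := U T y.
have NT := opnorm_ge0 (U T).
have yC2 : `|y| <= growth_const.
  apply/ler_addgt0Pr => e e0; have /cvgrPdist_le/(_ e e0) hy := cy.
  have : \forall s \near T^'-, `|y| <= growth_const + e.
    near=> s.
    have s0 : 0 < s by near: s; exact: nbhs_left_gt.
    have sT : s < T by near: s; exact: nbhs_left_lt.
    have ys : `|y - v s| <= e by near: s; exact: hy.
    have := pullback_bound u00 su (ltW s0) sT.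
    have := ler_normD (y - v s) (v s); rewrite subrK.
    by rewrite -/(v s); move: w0; lra.
  by move=> H; have [] := filter_ex H.
have hx : (`|xs|%:E < r)%E.
  apply: le_lt_trans (hr (ltW T0)); rewrite lee_fin.
  apply: (le_trans (le_opnorm _ (homogeneous_bounded_U hU (ltW T0)))).
  by rewrite mulrC ler_wpM2r.
have cu e : 0 < e -> \forall s \near T^'-, `|u s - xs| <= e.
  move=> e0.
  have hUs (s : R) : `[0, +oo[%classic s -> homogeneous_bounded (U s).
    by rewrite /= in_itv/= andbT; exact: (homogeneous_bounded_U hU).
  have [_ _ _ dU _] := hU.
  have IT : `[0, +oo[%classic T by rewrite /= in_itv/= andbT ltW.
  have hL : homogeneous_bounded (fun x => lin0 F T (U T x)).
    exact: homogeneous_bounded_comp (homogeneous_bounded_lin0 hFdiff (ltW T0)) (hUs T IT).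
  have lip := op_derives_near_lipschitz (A := fun s => U s : X -> X) IT hUs hL (dU T (ltW T0)).
  set K := 1 + _ in lip.
  have K0 : 0 < K by rewrite ltr_wpDr// opnorm_ge0.
  have D0 : 0 < K * growth_const by rewrite mulr_gt0// growth_const_gt0.
  have N1 : 0 < opnorm (U T) + 1 by rewrite ltr_wpDl.
  have e1 : 0 < e / 2 / (K * growth_const) by rewrite !divr_gt0.
  have e2 : 0 < e / 2 / (opnorm (U T) + 1) by rewrite !divr_gt0.
  have /cvgrPdist_le/(_ _ e2) hy := cy.
  near=> s.
  have s0 : 0 < s by near: s; exact: nbhs_left_gt.
  have sT : s < T by near: s; exact: nbhs_left_lt.
  have Is : `[0, +oo[%classic s by rewrite /= in_itv/= andbT ltW.
  have h1 : `|U s (v s) - U T (v s)| <= K * `|s - T| * `|v s|.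
    by move: Is (v s); near: s; apply: cvg_within; exact: lip.
  have h2 : `|y - v s| <= e / 2 / (opnorm (U T) + 1) by near: s; exact: hy.
  have h3 : `|s - T| < e / 2 / (K * growth_const).
    by near: s; apply: cvg_within; exact: near_dist_lt.
  have h4 : `|v s| <= growth_const.
    by have := pullback_bound u00 su (ltW s0) sT; rewrite /v; move: w0; lra.
  rewrite -(U_Uinv (u s) (ltW s0)) -/(v s) (splitr e).
  apply: (le_trans (ler_distD (U T (v s)) _ _)); apply: lerD.
    apply: (le_trans h1); rewrite mulrAC.
    apply: (@le_trans _ _ (K * growth_const * `|s - T|)).
      by rewrite ler_wpM2r// ler_wpM2l// ltW.
    by rewrite mulrC -ler_pdivlMr// ltW.
  rewrite /xs -linearB; apply: (le_trans (le_opnorm _ (hUs T IT))).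
  rewrite distrC; apply: (@le_trans _ _ ((opnorm (U T) + 1) * `|y - v s|)).
    by rewrite ler_wpM2r// lerDl.
  by rewrite mulrC -ler_pdivlMr.
have [d [z1 [d0 /solutionP sz1 _]]] := hls (ltW T0) hx.
have {sz1}[//|z1T sz1] := sz1 hFcont hfcont.
  by move=> s /=; rewrite !in_itv/= andbT => /andP[Ts _]; exact: le_trans (ltW T0) Ts.
pose z s := if s < T then u s else z1 s.
have zu s : s < T -> z s = u s by rewrite /z => ->.
have zz1 s : T <= s -> z s = z1 s by rewrite /z ltNge => ->.
have zT : z T = xs by rewrite zz1.
have zc x : 0 < x -> x <= T -> forall e, 0 < e -> \forall y \near x^'-, `|z y - z x| <= e.
  move=> x0; rewrite le_eqVlt => /predU1P[->|xT] e e0.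
    near=> s; have sT : s < T by near: s; exact: nbhs_left_lt.
    by rewrite zT zu//; near: s; exact: cu.
  have cx := solves_continuous su (inT x (ltW x0) xT) e0; near=> s.
  have sx : s < x by near: s; exact: nbhs_left_lt.
  have s0 : 0 < s by near: s; exact: nbhs_left_gt.
  have sT := lt_trans sx xT.
  rewrite !zu//; have := inT s (ltW s0) sT; near: s; apply: cvg_within.
  exact: cx.
have fc e : 0 < e -> \forall s \near T, 0 <= s -> s <= T ->
    `|velocity F f z s - velocity F f z T| <= e.
  move=> e0.
  have II : `[0, T]%classic `<=` (`[0, +oo[%classic : set R).
    by move=> x /=; rewrite !in_itv/= => /andP[->].
  have IT : `[0, T]%classic T by rewrite /= in_itv/= lexx ltW.
  have c e' : 0 < e' -> \forall s \near T, `[0, T]%classic s -> `|z s - z T| <= e'.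
    move=> e0'; have := zc T T0 (lexx T) e' e0'; rewrite /at_left near_withinE.
    apply: filterS => s hs /=; rewrite in_itv/= => /andP[_].
    rewrite le_eqVlt => /predU1P[->|]; first by rewrite subrr normr0 ltW.
    exact: hs.
  have /cvgrPdist_le/(_ e e0) := velocity_continuous hFcont hfcont II IT c.
  rewrite near_withinE; apply: filterS => s hs s0 sT.
  by rewrite distrC; apply: hs; rewrite /= in_itv/= s0.
exists d, z; split=> //; first by rewrite zu.
move=> t; rewrite /= in_itv/= => /andP[t0 tTd].
have It : `[0, T + d[%classic t by rewrite /= in_itv/= t0.
have [tT|Tt|tT] := ltgtP t T.
- apply: (first_order_local It (su t (inT t t0 tT))).
  near=> s; rewrite /= !in_itv/= => /andP[s0 _].
  have sT : s < T by near: s; exact: lt_nbhsl.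
  by rewrite s0 sT zu.
- have Jt : `[T, T + d[%classic t by rewrite /= in_itv/= (ltW Tt).
  apply: (first_order_local It (sz1 t Jt)).
  near=> s; rewrite /= !in_itv/= => /andP[s0 sTd].
  have Ts : T < s by near: s; exact: lt_nbhsr.
  by rewrite (ltW Ts) sTd zz1// ltW.
- rewrite {t It t0 tTd}tT => e e0; set l := velocity F f z T.
  have JT : `[T, T + d[%classic T by rewrite /= in_itv/= lexx ltrDl.
  have right := sz1 T JT e e0.
  have lE : velocity F f z1 T = l by rewrite /l /velocity zz1.
  have e2 : 0 < e / 2 by rewrite divr_gt0.
  have [rho /= rho0 hrho] := fc _ e2.
  near=> s; rewrite /= in_itv/= => /andP[s0 sTd].
  have [sT|Ts] := ltP s T; last first.
    rewrite (zz1 s)// (zz1 T)// -lE.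
    have : `[T, T + d[%classic s by rewrite /= in_itv/= Ts.
    by near: s; exact: right.
  have srho : `|s - T| < rho by near: s; exact: near_dist_lt.
  have -> : `|z s - z T - (s - T) *: l| = `|(z T - T *: l) - (z s - s *: l)|.
    by rewrite -[RHS]normrN opprB subrBB scalerBl.
  have -> : e * `|s - T| = e * T - e * s.
    by rewrite ltr0_norm ?subr_lt0//; ring.
  apply: (norm_increment (v := fun x => z x - x *: l) (Psi := fun x => e * x) (ltW sT)).
  + by move=> x y' _ xy _; rewrite ler_wpM2l// ltW.
  + move=> x sx xT e' e0'; have e2' : 0 < e' / 2 by rewrite divr_gt0.
    have l1 : 0 < `|l| + 1 by rewrite ltr_wpDl.
    have x0 := le_lt_trans s0 sx.
    near=> y'.
    have h1 : `|z y' - z x| <= e' / 2 by near: y'; exact: zc.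
    have h2 : `|y' - x| < e' / 2 / (`|l| + 1).
      by near: y'; apply: cvg_within; apply: near_dist_lt; rewrite divr_gt0.
    have -> : z y' - y' *: l - (z x - x *: l) = (z y' - z x) - (y' - x) *: l.
      by rewrite scalerBl subrBB.
    apply: (le_trans (ler_normB _ _)); rewrite (splitr e') lerD// normrZ.
    apply: (@le_trans _ _ (`|y' - x| * (`|l| + 1))); first by rewrite ler_wpM2l// lerDl.
    by rewrite -ler_pdivlMr// ltW.
  + move=> x sx xT; have x0 := le_trans s0 sx.
    have du := su x (inT x x0 xT) _ e2.
    have fx : `|velocity F f u x - l| <= e / 2.
      have -> : velocity F f u x = velocity F f z x by rewrite /velocity zu.
      apply: hrho => //=; last exact: ltW.
      rewrite gtr0_norm ?subr_gt0//; move: srho; rewrite ltr0_norm ?subr_lt0//.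
      by move: sx; lra.
    near=> y'.
    have xy : x < y' by near: y'; exact: nbhs_right_gt.
    have yT : y' < T by near: y'; exact: nbhs_right_lt.
    have h1 : `|u y' - u x - (y' - x) *: velocity F f u x| <= e / 2 * `|y' - x|.
      have := inT y' (le_trans x0 (ltW xy)) yT.
      by near: y'; apply: cvg_within; exact: du.
    rewrite !zu//.
    have -> : u y' - y' *: l - (u x - x *: l) =
        (u y' - u x - (y' - x) *: velocity F f u x) + (y' - x) *: (velocity F f u x - l).
      by rewrite scalerBr addrA subrK scalerBl subrBB.
    apply: (le_trans (ler_normD _ _)).
    have -> : e * y' - e * x = e / 2 * `|y' - x| + `|y' - x| * (e / 2).
      by rewrite gtr0_norm ?subr_gt0//; field.
    by rewrite lerD// normrZ ler_wpM2l.
Unshelve. all: by end_near. Qed.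

(** All local solutions are glued into one function [us] by uniqueness; a finite supremum
of their existence times would contradict [solution_extends]. *)
Lemma global_solution : exists u, u 0 = u0 /\ solves F f `[0, +oo[ u.
Proof.
pose solvable (T : R) := exists u, u 0 = u0 /\ solves F f `[0, T[ u.
have down (S T : R) : S <= T -> solvable T -> solvable S.
  move=> ST [u [u00 su]]; exists u; split=> //; apply: solves_sub su => x /=.
  by rewrite !in_itv/= => /andP[-> xS]; exact: lt_le_trans ST.
have [T1 T10 sT1] : exists2 T, 0 < T & solvable T.
  have hu0 : (`|u0|%:E < r)%E.
    apply: le_lt_trans (hr (lexx 0)); rewrite lee_fin.
    have e0 : Uinv 0 u0 = u0 by have [_ h _ _ _] := hU; have [_ ->] := h u0.
    apply: (le_trans (norm_le_pullback u0 (lexx 0))); rewrite mulrC ler_wpM2r ?opnorm_ge0//.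
    rewrite e0 /growth_const; set k := _ - _.
    have q0 : 0 < p - 1 by move: hp; lra.
    have c0 : 0 < `|u0| + w by rewrite ltr_wpDl.
    apply: (@le_trans _ _ (`|u0| + w)); first by rewrite lerDl ltW.
    have k0 : 0 < k by rewrite subr_gt0.
    apply: (le_powRNV q0 k0 c0).
    rewrite /k lerBlDr lerDl mulr_ge0// ?(ltW q0)// fine_ge0//.
    apply: integral_ge0 => x /=; rewrite in_itv/= andbT => x0.
    by rewrite lee_fin weight_ge0// halpha0.
  have [T [u [T0 /solutionP sol _]]] := hls (lexx 0) hu0.
  exists T => //; exists u; have [] := sol hFcont hfcont; rewrite add0r //.
  exact: itv_sub0.
have /choice[us hus] (t : R) : exists x, forall (T : R) u, 0 <= t -> t < T -> u 0 = u0 ->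
    solves F f `[0, T[ u -> u t = x.
  have [[T [u [t0 tT u00 su]]]|no] := pselect (exists (T : R) u,
      [/\ 0 <= t, t < T, u 0 = u0 & solves F f `[0, T[ u]).
    exists (u t) => T' u' _ tT' u'00 su'.
    exact: (solution_unique u'00 u00 su' su).
  by exists 0 => T u t0 tT u00 su; exfalso; apply: no; exists T, u.
have us0 : us 0 = u0.
  by have [u [u00 su]] := sT1; rewrite -(hus 0 T1 u).
have glue (I : set R) : I `<=` `[0, +oo[ ->
    (forall t, I t -> exists2 T, t < T & solvable T) -> solves F f I us.
  move=> Ipos h; apply: solves_local => t It; have [T tT [u [u00 su]]] := h t It.
  exists `[0, T[%classic, u; split => //.
    by have := Ipos t It; rewrite /= !in_itv/= andbT tT => ->.
  near=> s => Is.
  have s0 : 0 <= s by have := Ipos s Is; rewrite /= in_itv/= andbT.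
  have sT : s < T by near: s; exact: lt_nbhsl.
  by split; [rewrite /= in_itv/= s0|rewrite (hus s T u)].
have all T : solvable T.
  apply: contrapT => nT.
  have ub : ubound [set S | solvable S] T.
    by move=> S sS; rewrite leNgt; apply/negP => /ltW TS; apply: nT; exact: down sS.
  have supS : has_sup [set S | solvable S] by split; [exists T1|exists T].
  pose Ts := sup [set S | solvable S].
  have T1s : T1 <= Ts by apply: ub_le_sup => //; exists T.
  have Ts0 : 0 < Ts by exact: lt_le_trans T1s.
  have sus : solves F f `[0, Ts[ us.
    apply: glue; first exact: itv_sub0.
    move=> t; rewrite /= in_itv/= => /andP[t0 tTs].
    have tt : 0 < Ts - t by rewrite subr_gt0.
    have [S sS lt] := sup_adherent tt supS; exists S => //.
    by move: lt; rewrite -/Ts opprB addrC subrK.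
  have [d [z [d0 z0 sz]]] := solution_extends Ts0 us0 sus.
  have : Ts + d <= Ts by apply: ub_le_sup; [exists T|exists z].
  by rewrite gerDl leNgt d0.
exists us; split => //; apply: glue => // t _.
by exists (t + 1); [rewrite ltrDl|exact: all].
Unshelve. all: by end_near. Qed.

End Continuation.
End Dynamics.

(** * Global existence and the growth bound *)

Theorem theorem2p6 (R : realType) (X : completeNormedModType R)
  (F : R -> X -> X) (f : R -> X) (alpha beta : R -> R) (p : R) (u0 : X)
  (U Uinv : R -> {linear X -> X})
  (hp : 1 < p)
  (hFcont : {within `[0, +oo[ `*` [set: X], continuous (fun z : R * X => F z.1 z.2)})
  (hfcont : {within `[0, +oo[, continuous f})
  (hFdiff : forall t : R, 0 <= t -> differentiable (F t) (0 : X))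
  (hB : L1loc (fun t => opnorm (lin0 F t)))
  (halpha0 : forall t : R, 0 <= t -> 0 <= alpha t) (halpha : L1loc alpha)
  (hbeta0 : forall t : R, 0 <= t -> 0 <= beta t) (hbeta : L1loc beta)
  (hF : forall (t : R) (x : X), 0 <= t -> `|F t x - lin0 F t x| <= alpha t * `|x| `^ p)
  (hf : forall t : R, 0 <= t -> `|f t| <= beta t)
  (hU : is_evolution (lin0 F) U Uinv)
  (homega : (omega p alpha beta (fun t => U t : X -> X)
             < threshold p alpha (fun t => U t : X -> X) (fun t => Uinv t : X -> X)
               - `|u0|%:E)%E) :
  exists2 C2 : R, 0 < C2 &
    (* r sufficiently large *)
    forall r : \bar R, (forall t : R, 0 <= t -> ((C2 * opnorm (U t))%:E < r)%E) ->
    locally_solvable F f r ->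
    exists u : R -> X,
      [/\ solution F f 0 u0 `[0, +oo[ u,
          forall (T : R) (w : R -> X), 0 < T ->
            solution F f 0 u0 `[0, T[ w ->
            forall t : R, 0 <= t -> t < T -> w t = u t,
          forall t : R, 0 <= t -> `|u t| <= C2 * opnorm (U t),
          has_ubound [set opnorm (U t) | t in `[0, +oo[ ] ->
            [bounded u t | t in `[0, +oo[ ]
        & opnorm (U t) @[t --> +oo] --> (0 : R) ->
            u t @[t --> +oo] --> (0 : X)].
Proof.
have p1 : 0 < p - 1 by rewrite subr_gt0.
have p0 : 0 < p by rewrite (lt_trans _ hp).
have I0ge0 : (0 <= \int[@lebesgue_measure R]_(x in `[0%R, +oo[)
    (weight U Uinv p alpha x)%:E)%E.
  apply: integral_ge0 => x /=; rewrite in_itv/= andbT => x0.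
  by rewrite lee_fin weight_ge0// halpha0.
have [hI0 [w [w0 omw hmargin]]] := threshold_margin p1 (normr_ge0 u0)
  (omega_ge0 p alpha beta (fun t => U t : X -> X)) I0ge0 homega.
have hbw t : 0 <= t -> beta t <= alpha t * (w * opnorm (U t)) `^ p.
  by move=> t0; apply: (omega_bound p0 t0 (halpha0 t t0) (hbeta0 t t0) (ltW w0) omw).
pose C := growth_const alpha p u0 U Uinv w.
have C0 : 0 < C by exact: growth_const_gt0.
exists C => // r hr hls.
have [u [u00 su]] := global_solution hp hFcont hfcont hFdiff halpha0 halpha hF hf hU
  w0 hbw hI0 hmargin hr hls.
have suT (T : R) : solves F f `[0, T[ u by apply: solves_sub su; exact: itv_sub0.
have bound t : 0 <= t -> `|u t| <= C * opnorm (U t).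
  move=> t0; apply: (solution_bound hp hFdiff halpha0 halpha hF hf hU w0 hbw hI0 hmargin
    u00 (suT (t + 1)) t0); by rewrite ltrDl.
exists u; split => //.
- by apply/solutionP.
- move=> T v T0 /solutionP[]//; first exact: itv_sub0.
  move=> v0 sv t t0 tT.
  exact: (solution_unique hp hFcont hfcont hFdiff halpha0 halpha hF hf hU w0 hbw hI0
    hmargin hr hls v0 u00 sv (suT T) t0 tT tT).
- move=> [M hM]; exists (C * M); split; first exact: num_real.
  move=> x Cx t /=; rewrite in_itv/= andbT => t0.
  apply: (le_trans (bound t t0)); apply: ltW; apply: le_lt_trans Cx.
  rewrite ler_wpM2l ?(ltW C0)//; apply: hM; exists t => //=.
  by rewrite in_itv/= andbT.
- move=> /cvgrPdist_le hN; apply/cvgrPdist_le => e e0.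
  have e1 : 0 < e / C by rewrite divr_gt0.
  have hNe := hN _ e1.
  near=> t.
  have t0 : 0 <= t by near: t; exact: nbhs_pinfty_ge.
  rewrite sub0r normrN; apply: (le_trans (bound t t0)).
  rewrite mulrC -ler_pdivlMr//.
  have : `|0 - opnorm (U t)| <= e / C by near: t; exact: hNe.
  by rewrite sub0r normrN ger0_norm// opnorm_ge0.
Unshelve. all: by end_near. Qed.
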